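(* There is a $3$-approximation algorithm for (iK-dm) that runs in polynomial time. That is, there is a polynomial-time algorithm which, for every instance of (iK-dm), returns a feasible solution whose objective value is at least $\tfrac13$ of the optimal objective value.
   Context: The multi-level improvable knapsack problem with discrete weight improvements (iK-dm): there are $n$ items; item $i$ has profit $p_i\ge 0$, weights $w_i=w_i^0\ge w_i^1\ge\ldots\ge w_i^{j(i)}\ge 0$ and improvement costs $0=c_i^0\le c_i^1\le\ldots\le c_i^{j(i)}$, where $j(i)$ is the number of improvement levels of item $i$. There are a knapsack budget $B\ge 0$ and an improvement budget $C\ge 0$. All data are rational. The problem is $$\max \sum_{i=1}^n p_ix_i\quad\text{s.t.}\quad \sum_{i=1}^n w_i x_i+\sum_{i=1}^n\sum_{\ell=1}^{j(i)}(w_i^\ell-w_i^{\ell-1})y_i^\ell\le B,\quad \sum_{i=1}^n\sum_{\ell=1}^{j(i)}(c_i^\ell-c_i^{\ell-1})y_i^\ell\le C,$$ $$y_i^{j(i)}\le y_i^{j(i)-1}\le\ldots\le y_i^1\le x_i,\quad x_i\in\{0,1\},\quad y_i^\ell\in\{0,1\}\quad\text{for all } i\in\{1,\ldots,n\},\ \ell\in\{1,\ldots,j(i)\}.$$ *)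

(* Defs.v *)
From mathcomp Require Import all_boot all_order all_algebra.

Set Implicit Arguments.
Unset Strict Implicit.
Unset Printing Implicit Defensive.

Import Order.TTheory GRing.Theory Num.Theory.
Local Open Scope ring_scope.

(* The problem (iK-dm).  [weight i l] and [cost i l] stand for w_i^l and c_i^l;
   they are meaningful for l <= levels i only (level 0 is the unimproved item)
   and are never looked at beyond that. *)

Record instance := Instance {
  nitems : nat;
  levels : 'I_nitems -> nat;
  profit : 'I_nitems -> rat;
  weight : 'I_nitems -> nat -> rat;
  cost : 'I_nitems -> nat -> rat;
  knapsack_budget : rat;
  improvement_budget : rat;
  profit_ge0 : forall i, 0 <= profit i;
  weight_ge0 : forall i l, (l <= levels i)%N -> 0 <= weight i l;
  weight_anti : forall i l, (l < levels i)%N -> weight i l.+1 <= weight i l;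
  cost0 : forall i, cost i 0%N = 0;
  cost_mono : forall i l, (l < levels i)%N -> cost i l <= cost i l.+1;
  knapsack_budget_ge0 : 0 <= knapsack_budget;
  improvement_budget_ge0 : 0 <= improvement_budget }.

(* [ysol s i l] is y_i^l, meaningful for 1 <= l <= levels i only. *)
Record solution (I : instance) := Solution {
  xsol : 'I_(nitems I) -> bool;
  ysol : 'I_(nitems I) -> nat -> bool }.

Section Problem.
Variable I : instance.
Implicit Type s : solution I.

Definition objective s : rat := \sum_i profit i * (xsol s i)%:R.

Definition total_weight s : rat :=
  \sum_i weight i 0%N * (xsol s i)%:R
  + \sum_i \sum_(1 <= l < (levels i).+1)
      (weight i l - weight i l.-1) * (ysol s i l)%:R.

Definition improvement_cost s : rat :=
  \sum_i \sum_(1 <= l < (levels i).+1)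
      (cost i l - cost i l.-1) * (ysol s i l)%:R.

Definition feasible s : Prop :=
  [/\ total_weight s <= knapsack_budget I,
      improvement_cost s <= improvement_budget I,
      forall i, (0 < levels i)%N -> ysol s i 1%N ==> xsol s i
    & forall i l, (0 < l < levels i)%N -> ysol s i l.+1 ==> ysol s i l].

Definition optimal s : Prop :=
  feasible s /\ forall s', feasible s' -> objective s' <= objective s.

End Problem.

(* Model of computation: structured programs for a random access machine over
   the integers, under the logarithmic cost criterion (every operation is
   charged the bit lengths of the integers and addresses it handles), which is
   polynomially equivalent to Turing machines.  The memory consists of arrays
   of integers; a program names finitely many of them, and a scalar variable
   is cell 0 of an array.  A computed index z addresses cell |z|. *)

Definition memory := nat -> nat -> int.

Inductive binop := Add | Sub | Mul | Div.

Inductive expr :=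
  | Const of int
  | Get of nat & expr
  | Bin of binop & expr & expr.

Inductive program :=
  | Skip
  | Set_ of nat & expr & expr
  | Seq of program & program
  | If of expr & program & program
  | While of expr & program.

Definition bitlen (z : int) : nat := (trunc_log 2 `|z|%N).+2.

Definition eval_binop (o : binop) (u v : int) : int :=
  match o with
  | Add => u + v
  | Sub => u - v
  | Mul => u * v
  | Div => (u %/ v)%Z
  end.

Fixpoint eval (m : memory) (e : expr) : int :=
  match e with
  | Const z => z
  | Get a e1 => m a `|eval m e1|%N
  | Bin o e1 e2 => eval_binop o (eval m e1) (eval m e2)
  end.

Fixpoint eval_time (m : memory) (e : expr) : nat :=
  match e with
  | Const z => bitlen z
  | Get _ e1 => (eval_time m e1 + bitlen (eval m e1) + bitlen (eval m e))%N
  | Bin _ e1 e2 => (eval_time m e1 + eval_time m e2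
                    + bitlen (eval m e1) + bitlen (eval m e2))%N
  end.

Definition update (m : memory) (a k : nat) (z : int) : memory :=
  fun a' k' => if (a' == a) && (k' == k) then z else m a' k'.

(* [Set_ a e1 e2] stores the value of e2 in cell e1 of array a; tests succeed
   on positive values. *)
Inductive run : program -> memory -> nat -> memory -> Prop :=
  | RunSkip m : run Skip m 1 m
  | RunSet a e1 e2 m :
      run (Set_ a e1 e2) m
        (eval_time m e1 + eval_time m e2
         + bitlen (eval m e1) + bitlen (eval m e2))%N
        (update m a `|eval m e1|%N (eval m e2))
  | RunSeq p1 p2 m t1 m1 t2 m2 :
      run p1 m t1 m1 -> run p2 m1 t2 m2 -> run (Seq p1 p2) m (t1 + t2)%N m2
  | RunIfTrue e p1 p2 m t m1 :
      0 < eval m e -> run p1 m t m1 ->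
      run (If e p1 p2) m (eval_time m e + bitlen (eval m e) + t)%N m1
  | RunIfFalse e p1 p2 m t m1 :
      eval m e <= 0 -> run p2 m t m1 ->
      run (If e p1 p2) m (eval_time m e + bitlen (eval m e) + t)%N m1
  | RunWhileTrue e p m t1 m1 t2 m2 :
      0 < eval m e -> run p m t1 m1 -> run (While e p) m1 t2 m2 ->
      run (While e p) m (eval_time m e + bitlen (eval m e) + t1 + t2)%N m2
  | RunWhileFalse e p m :
      eval m e <= 0 ->
      run (While e p) m (eval_time m e + bitlen (eval m e))%N m.

(* Input: the sequence
     n, B, C, and for each item  j(i), p_i, w_i^0, c_i^0, ..., w_i^j(i), c_i^j(i),
   a rational being written as its reduced numerator followed by its
   denominator; it is placed in array 0, all other cells being 0. *)

Definition encode_rat (q : rat) : seq int := [:: numq q; denq q].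

Definition encode_item (I : instance) (i : 'I_(nitems I)) : seq int :=
  (levels i)%:Z :: encode_rat (profit i)
  ++ flatten [seq encode_rat (weight i l) ++ encode_rat (cost i l)
             | l <- iota 0%N (levels i).+1].

Definition encode (I : instance) : seq int :=
  (nitems I)%:Z :: encode_rat (knapsack_budget I)
  ++ encode_rat (improvement_budget I)
  ++ flatten [seq encode_item i | i <- enum 'I_(nitems I)].

Definition input_memory (I : instance) : memory :=
  fun a k => if a == 0%N then nth 0 (encode I) k else 0.

Definition input_size (I : instance) : nat := (\sum_(z <- encode I) bitlen z)%N.

(* Output: x_i, y_i^1, ..., y_i^j(i) for each item in turn, in array 1. *)

Definition encode_solution (I : instance) (s : solution I) : seq int :=
  flatten [seq (xsol s i : nat)%:Z
               :: [seq (ysol s i l : nat)%:Z | l <- iota 1%N (levels i)]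
          | i <- enum 'I_(nitems I)].

Definition outputs (I : instance) (m : memory) (s : solution I) : Prop :=
  forall k, (k < size (encode_solution s))%N ->
    m 1%N k = nth 0 (encode_solution s) k.

(* Main.v *)
Require Import Defs.
From mathcomp Require Import all_boot all_order all_algebra.
From mathcomp Require Import zify ring.
Import Order.TTheory GRing.Theory Num.Theory.
Local Open Scope ring_scope.

Set Implicit Arguments.
Unset Strict Implicit.
Unset Printing Implicit Defensive.

(** A solution of the problem amounts to a level assignment [a]: [a i = 0] when
    item [i] is left out, and [a i = k + 1] when it is packed at level [k].  So
    one has to choose at most one pair (weight, cost) per item, subject to two
    budgets.

    Fix an optimal assignment, and guess its most profitable item [g] and the
    level [l] of [g].  After scaling, all data are integers; let [b - 1] and
    [d - 1] be the budgets left once [g] is packed at level [l].  Merge both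
    constraints into the surrogate size [w_i^k d + c_i^k b] of item [i] at level
    [k], and give each item the level which minimizes it.  A set of items of
    total size less than [b d] fits in the remaining budgets, whereas the rest of
    the optimum has total size less than [2 b d].  Adding items no more
    profitable than [g] by increasing ratio size / profit until the size reaches
    [b d] therefore collects at least half of the profit of that rest
    ([prefix_half]).  The item [h] which makes the size reach [b d] has to be
    dropped, which loses at most the profit of [g].  With [A] the items before
    [h], this gives

      OPT <= p_g + 2 (p(A) + p_g) <= 3 (p_g + p(A)),

    so that [g] together with [A] is worth a third of the optimum
    ([greedy_third]).

    There are polynomially many triples [(g, l, h)]: the algorithm tries them
    all and keeps the best feasible one.  Its running time is not analysed by
    hand.  The output is written as a closed term built from arithmetic, bounded
    sums and bounded products over the input ([toutput]), and every such term is
    compiled to a program whose running time is polynomial in the size of the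
    input ([computedP]), because nothing but a bounded number of bounded loops
    can be expressed.  The only loop outside of this scheme scans the input to
    find where the items start ([preludeP]).  What remains is to compute the
    value of the output term ([ev_toutput]) and to translate between assignments
    and solutions. *)

(** * The cost of expressions and loops *)

Lemma bitlen_leP (z : int) b : (0 < b)%N ->
  (bitlen z <= b.+1)%N = (`|z| < 2 ^ b)%N.
Proof.
move=> b0; rewrite /bitlen ltnS; case: (posnP `|z|%N) => [->|z0].
  by rewrite trunc_log0 b0 expn_gt0.
apply/idP/idP => h.
  by apply: leq_trans (trunc_log_ltn _ (isT : (1 < 2)%N)) _; rewrite leq_exp2l.
by have := leq_ltn_trans (trunc_logP (isT : (1 < 2)%N) z0) h; rewrite ltn_exp2l.
Qed.

Lemma bitlen_nat n : (bitlen n%:Z <= n.+2)%N.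
Proof. by rewrite bitlen_leP // absz_nat; apply: ltn_trans (ltn_expl _ _). Qed.

Lemma bitlen_binop o u v :
  (bitlen (eval_binop o u v) <= bitlen u + bitlen v)%N.
Proof.
have h z : exists2 b, (0 < b)%N & bitlen z = b.+1 /\ (`|z| < 2 ^ b)%N.
  by exists (bitlen z).-1 => //; split=> //; rewrite -bitlen_leP.
have [a a0 [-> ua]] := h u; have [b b0 [-> vb]] := h v.
rewrite addSn addnS; apply: leqW; rewrite bitlen_leP ?addn_gt0 ?a0 // expnD.
have h2 c : (0 < c)%N -> (2 <= 2 ^ c)%N by case: c => // c _; rewrite expnS leq_pmulr // expn_gt0.
move: (h2 _ a0) (h2 _ b0) ua vb; set x := (2 ^ a)%N; set y := (2 ^ b)%N => x2 y2 ua vb.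
case: o => /=.
- by nia.
- by nia.
- by rewrite abszM ltn_mul.
- apply: leq_ltn_trans (_ : `|u|%N < _)%N; last by nia.
  by have := lez_div u v; lia.
Qed.

Lemma bitlen0 : bitlen 0 = 2. Proof. by []. Qed.

Lemma bitlen1 : bitlen 1 = 2. Proof. by []. Qed.

(** Under the logarithmic criterion the cost of an expression is linear in the
    length of the cells that it reads; this is the factor. *)
Fixpoint expr_cost (e : expr) : nat :=
  match e with
  | Const z => bitlen z
  | Get _ e1 => ((expr_cost e1).*2 + 1)%N
  | Bin _ e1 e2 => (expr_cost e1 + expr_cost e2).*2
  end.

Fixpoint reads_le (L : nat) (m : memory) (e : expr) : bool :=
  match e with
  | Const _ => true
  | Get a e1 => reads_le L m e1 && (bitlen (m a `|eval m e1|%N) <= L)%N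
  | Bin _ e1 e2 => reads_le L m e1 && reads_le L m e2
  end.

Lemma expr_costP L m e : (0 < L)%N -> reads_le L m e ->
  (bitlen (eval m e) <= expr_cost e * L)%N /\
  (eval_time m e <= expr_cost e * L)%N.
Proof.
move=> L0; elim: e => [z|a e IH|o e1 IH1 e2 IH2] /=.
- by move=> _; rewrite leq_pmulr.
- move=> /andP[/IH[h1 h2] h]; split; first by apply: leq_trans h _; nia.
  by apply: leq_trans (leq_add (leq_add h2 h1) h) _; nia.
- move=> /andP[/IH1[h1 h2] /IH2[h3 h4]]; split.
    by apply: leq_trans (bitlen_binop _ _ _) _; nia.
  by nia.
Qed.

Lemma run_set L a e1 e2 m : (0 < L)%N -> reads_le L m e1 -> reads_le L m e2 ->
  exists2 t, (t <= (expr_cost e1 + expr_cost e2).*2 * L)%N &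
    run (Set_ a e1 e2) m t (update m a `|eval m e1|%N (eval m e2)).
Proof.
move=> L0 /(expr_costP L0)[h1 h2] /(expr_costP L0)[h3 h4].
eexists; last exact: RunSet.
by nia.
Qed.

(** The rounds are counted by the invariant, so that the program is free to keep
    its counter in any cell and to test it in any way. *)
Lemma run_for (Inv : nat -> memory -> Prop) e p n tc tb :
  (forall i m, (i < n)%N -> Inv i m ->
     [/\ 0 < eval m e, (eval_time m e + bitlen (eval m e) <= tc)%N
       & exists t m', [/\ run p m t m', (t <= tb)%N & Inv i.+1 m']]) ->
  (forall m, Inv n m ->
     eval m e <= 0 /\ (eval_time m e + bitlen (eval m e) <= tc)%N) ->
  forall m, Inv 0%N m -> exists t m',
    [/\ run (While e p) m t m', (t <= n * (tc + tb) + tc)%N & Inv n m'].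
Proof.
move=> step stop.
suff gen k : forall i m, (i + k)%N = n -> Inv i m -> exists t m',
    [/\ run (While e p) m t m', (t <= k * (tc + tb) + tc)%N & Inv n m'].
  by move=> m; apply: gen.
elim: k => [|k IH] i m ik Im.
  rewrite -ik addn0 in stop *; have [le0 tt] := stop _ Im.
  by eexists _, m; split; [exact: RunWhileFalse|lia|].
have lt : (i < n)%N by lia.
have [gt0 htc [t1 [m1 [r1 ht1 I1]]]] := step _ _ lt Im.
have [t2 [m2 [r2 ht2 I2]]] := IH i.+1 m1 (etrans (addSnnS _ _) ik) I1.
eexists _, m2; split; [exact: RunWhileTrue gt0 r1 r2| |by []].
by rewrite mulSn; lia.
Qed.

(** * Terms and their compilation *)

(** Closed under sums and products over a range of polynomial length, but
    without any other iteration: the length of a value can only grow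
    polynomially.  Bound variables are de Bruijn indices, [Arg 0] being the
    innermost one. *)
Inductive term :=
  | Cst of int
  | Arg of nat
  | Inp of term
  | Off of term
  | Op of binop & term & term
  | Pos of term
  | Sum of term
  | Prd of term
  | Let of term & term.

(** [inp] is the input, [off] the table of the positions of the items in it, and
    [N] the common length of all ranges. *)
Section Value.
Variables (inp off : nat -> int) (N : nat).

Fixpoint value (v : seq int) (t : term) : int :=
  match t with
  | Cst z => z
  | Arg k => nth 0 v k
  | Inp t => inp `|value v t|%N
  | Off t => off `|value v t|%N
  | Op o t1 t2 => eval_binop o (value v t1) (value v t2)
  | Pos t => (0 < value v t)%R
  | Sum t => \sum_(0 <= i < N) value (i%:Z :: v) t
  | Prd t => \prod_(0 <= i < N) value (i%:Z :: v) t
  | Let t1 t2 => value (value v t1 :: v) t2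
  end.

End Value.

(** Arrays 0 to 3 hold the input, the output, the positions of the items and the
    range [N]; each array from 4 on is used as a register, through its cell 0. *)
Definition reg r := Get r (Const 0).
Definition setreg r e := Set_ r (Const 0) e.

Definition compile_loop o (z : int) r (body : program) :=
  Seq (setreg r (Const z)) (Seq (setreg r.+1 (Const 0))
    (While (Bin Defs.Sub (reg 3) (reg r.+1))
      (Seq body (Seq (setreg r (Bin o (reg r) (reg r.+2)))
                     (setreg r.+1 (Bin Defs.Add (reg r.+1) (Const 1))))))).

(** Registers form a stack: the value of the term goes to register [r], the
    registers above [r] are scratch space, and [rs] lists the registers, all
    below [r], which contain the bound variables. *)
Fixpoint compile (rs : seq nat) (r : nat) (t : term) : program :=
  match t with
  | Cst z => setreg r (Const z)
  | Arg k => setreg r (if (k < size rs)%N then reg (nth 0%N rs k) else Const 0)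
  | Inp t => Seq (compile rs r t) (setreg r (Get 0 (reg r)))
  | Off t => Seq (compile rs r t) (setreg r (Get 2 (reg r)))
  | Op o t1 t2 => Seq (compile rs r t1) (Seq (compile rs r.+1 t2)
                    (setreg r (Bin o (reg r) (reg r.+1))))
  | Pos t => Seq (compile rs r t)
               (If (reg r) (setreg r (Const 1)) (setreg r (Const 0)))
  | Sum t => compile_loop Defs.Add 0 r (compile (r.+1 :: rs) r.+2 t)
  | Prd t => compile_loop Defs.Mul 1 r (compile (r.+1 :: rs) r.+2 t)
  | Let t1 t2 => Seq (compile rs r t1) (Seq (compile (r :: rs) r.+1 t2)
                    (setreg r (reg r.+1)))
  end.

Definition frame r (m m' : memory) := forall a k, (a < r)%N -> m' a k = m a k.

Definition holds (inp off : nat -> int) N r rs v (m : memory) : Prop :=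
  [/\ m 0%N =1 inp, m 2%N =1 off, m 3%N 0%N = N%:Z :> int,
      [seq m q 0%N | q <- rs] = v & all (fun q => 3 < q < r)%N rs].

Definition small L (inp off : nat -> int) v : Prop :=
  [/\ forall k, (bitlen (inp k) <= L)%N, forall k, (bitlen (off k) <= L)%N
    & all (fun z => bitlen z <= L)%N v].

(** The exponent [e1] depends on the term and on the exponent [e0] of the data,
    but on nothing else, and this is what polynomial time means here.  Only the
    input, the table and the bound variables are required to be small.  The
    content of the scratch registers is not: a loop would otherwise have to
    bound its accumulator before the exponent of its body is known. *)
Definition computed t := forall e0, exists e1,
  forall X inp off N v, (1 < X)%N -> (N <= X)%N -> small (X ^ e0) inp off v ->
  (bitlen (value inp off N v t) <= X ^ e1)%N /\
  forall rs r m, (3 < r)%N -> holds inp off N r rs v m ->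
    exists tm m', [/\ run (compile rs r t) m tm m', (tm <= X ^ e1)%N,
      frame r m m' & m' r 0%N = value inp off N v t].

Lemma holds_frame inp off N r rs v m m' : (3 < r)%N -> frame r m m' ->
  holds inp off N r rs v m -> holds inp off N r rs v m'.
Proof.
move=> r3 fr [h0 h2 h3 hv hr]; split=> // [k|k||].
- by rewrite fr //; lia.
- by rewrite fr //; lia.
- by rewrite fr.
- rewrite -hv; apply/eq_in_map => q qr; apply: fr.
  by have /andP[] := allP hr _ qr.
Qed.

Lemma holds_wider inp off N r r' rs v m : (r <= r')%N ->
  holds inp off N r rs v m -> holds inp off N r' rs v m.
Proof.
move=> rr [h0 h2 h3 hv hr]; split=> //; apply/allP => q /(allP hr).
by lia.
Qed.

Lemma frame_trans r m1 m2 m3 : frame r m1 m2 -> frame r m2 m3 -> frame r m1 m3.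
Proof. by move=> f1 f2 a k ar; rewrite f2 ?f1. Qed.

Lemma frame_wider r r' m m' : (r <= r')%N -> frame r' m m' -> frame r m m'.
Proof. by move=> rr f a k ar; apply: f; apply: leq_trans rr. Qed.

Lemma frame_update r r' m z : (r <= r')%N -> frame r m (update m r' 0%N z).
Proof. by move=> rr a k ar; rewrite /update; case: eqP => //; lia. Qed.

Lemma updateE m a z : update m a 0%N z a 0%N = z.
Proof. by rewrite /update !eqxx. Qed.

Lemma small_le L L' inp off v : (L <= L')%N -> small L inp off v -> small L' inp off v.
Proof.
move=> LL [hi ho hv]; split=> [k|k|]; [exact: leq_trans LL|exact: leq_trans LL|].
by apply/allP => z /(allP hv) h; apply: leq_trans LL.
Qed.

(** Since [X >= 2], constant factors are absorbed into the exponent.  The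
    two and three digit numerals in the exponents below are such factors, rounded up. *)
Lemma mul_expn_le X c e : (1 < X)%N -> (c * X ^ e <= X ^ (c + e))%N.
Proof. by move=> X1; rewrite expnD leq_mul2r (ltnW (ltn_expl _ _)) ?orbT. Qed.

Lemma expn_le X a b : (1 < X)%N -> (a <= b)%N -> (X ^ a <= X ^ b)%N.
Proof. by move=> X1 ab; rewrite leq_exp2l. Qed.

Lemma run_setreg L r e m : (0 < L)%N -> reads_le L m e ->
  exists2 t, (t <= (2 + expr_cost e).*2 * L)%N &
    run (setreg r e) m t (update m r 0%N (eval m e)).
Proof.
move=> L0 h.
by have [t tl rn] := run_set r L0 (isT : reads_le L m (Const 0)) h; exists t.
Qed.

Lemma computed_Cst z : computed (Cst z).
Proof.
move=> e0; exists ((2 + bitlen z).*2 + 0)%N => X inp off N v X1 _ _.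
have X0 : (0 < X ^ 0)%N by [].
split=> [|rs r m r3 _] /=.
  by apply: leq_trans (mul_expn_le _ _ X1); rewrite muln1; lia.
have [t tl rn] := @run_setreg (X ^ 0) r (Const z) m X0 isT.
exists t, (update m r 0%N z); split=> //; first exact: leq_trans tl (mul_expn_le _ _ X1).
- exact: frame_update.
- exact: updateE.
Qed.

Lemma computed_Arg k : computed (Arg k).
Proof.
move=> e0; exists (14 + e0.+1)%N => X inp off N v X1 _ [_ _ hv].
have X0 : (0 < X ^ e0.+1)%N by rewrite expn_gt0; lia.
have X2 : (2 <= X ^ e0.+1)%N by rewrite expnS; have := expn_gt0 X e0; nia.
have hk : (bitlen (nth 0%R v k) <= X ^ e0.+1)%N.
  have [kv|kv] := ltnP k (size v); last by rewrite nth_default.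
  by apply: leq_trans (allP hv _ (mem_nth _ kv)) (expn_le _ _).
split=> [|rs r m r3 [_ _ _ hrs _]].
  by apply: leq_trans hk (expn_le _ _) => //; lia.
have hval : eval m (if (k < size rs)%N then reg (nth 0%N rs k) else Const 0) = nth 0 v k.
  rewrite -hrs; have [kr|kr] := ltnP; first by rewrite (nth_map 0%N).
  by rewrite nth_default ?size_map.
have [t tl rn] : exists2 t, (t <= 14 * X ^ e0.+1)%N &
    run (compile rs r (Arg k)) m t (update m r 0%N (nth 0%R v k)).
  rewrite -[in update _ _ _ _]hval /=; move: hval; case: ifP => _ hval.
    have [|t tl rn] := @run_setreg (X ^ e0.+1) r (reg (nth 0%N rs k)) m X0.
      by move: hval; rewrite /= => ->.
    by exists t.
  have [t tl rn] := @run_setreg (X ^ e0.+1) r (Const 0) m X0 isT.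
  by exists t => //; apply: leq_trans tl _; rewrite /= leq_mul2r orbT.
exists t, (update m r 0%N (nth 0%R v k)); split=> //.
- exact: leq_trans tl (mul_expn_le _ _ X1).
- exact: frame_update.
- exact: updateE.
Qed.

Lemma reads_reg L m r : (bitlen (m r 0%N) <= L)%N -> reads_le L m (reg r).
Proof. by []. Qed.

(** The common part of [Inp] and [Off]: looking up a table at a computed
    index. *)
Lemma computed_table (a : nat) (F : term -> term) t :
  (forall rs r, compile rs r (F t) = Seq (compile rs r t) (setreg r (Get a (reg r)))) ->
  (a = 0%N /\ (forall inp off N v, value inp off N v (F t) = inp `|value inp off N v t|%N) \/
   a = 2 /\ (forall inp off N v, value inp off N v (F t) = off `|value inp off N v t|%N)) ->
  computed t -> computed (F t).
Proof.
move=> hc ha IH e0; have [e1 {}IH] := IH e0.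
exists (27 + (e0 + e1))%N => X inp off N v X1 NX sm; have [vb {}IH] := IH _ _ _ _ _ X1 NX sm.
have ge0 : (X ^ e0 <= X ^ (e0 + e1))%N by rewrite expn_le // leq_addr.
have ge1 : (X ^ e1 <= X ^ (e0 + e1))%N by rewrite expn_le // leq_addl.
set L := (X ^ (e0 + e1))%N in ge0 ge1.
have L0 : (0 < L)%N by rewrite expn_gt0; lia.
have [hi ho _] := sm.
have bnd : (bitlen (value inp off N v (F t)) <= L)%N.
  by case: ha => [[_ ->]|[_ ->]]; apply: leq_trans ge0; [apply: hi|apply: ho].
split=> [|rs r m r3 hm]; first by apply: leq_trans bnd (expn_le _ _) => //; lia.
have [t1 [m1 [r1 ht1 f1 v1]]] := IH rs r m r3 hm.
have [h0 h2 _ _ _] := holds_frame r3 f1 hm.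
have ev : eval m1 (Get a (reg r)) = value inp off N v (F t).
  by rewrite /= v1; case: ha => [[-> ->]|[-> ->]].
have [|t2 ht2 r2] := @run_setreg L r (Get a (reg r)) m1 L0.
  by move: ev; rewrite /= => ->; rewrite bnd v1 (leq_trans vb ge1).
exists (t1 + t2)%N, (update m1 r 0%N (eval m1 (Get a (reg r)))); split.
- by rewrite hc; apply: RunSeq r1 r2.
- apply: leq_trans (mul_expn_le _ _ X1); move: ht2; rewrite -/L /= bitlen0 => ht2; lia.
- exact: frame_trans f1 (frame_update _ _ _).
- by rewrite updateE.
Qed.

Lemma computed_Inp t : computed t -> computed (Inp t).
Proof. by apply: computed_table => //; left. Qed.

Lemma computed_Off t : computed t -> computed (Off t).
Proof. by apply: computed_table => //; right. Qed.

Lemma computed_Op o t1 t2 : computed t1 -> computed t2 -> computed (Op o t1 t2).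
Proof.
move=> IH1 IH2 e0; have [e1 {}IH1] := IH1 e0; have [e2 {}IH2] := IH2 e0.
exists (46 + (e1 + e2))%N => X inp off N v X1 NX sm.
have [vb1 {}IH1] := IH1 _ _ _ _ _ X1 NX sm; have [vb2 {}IH2] := IH2 _ _ _ _ _ X1 NX sm.
have ge1 : (X ^ e1 <= X ^ (e1 + e2))%N by rewrite expn_le // leq_addr.
have ge2 : (X ^ e2 <= X ^ (e1 + e2))%N by rewrite expn_le // leq_addl.
set L := (X ^ (e1 + e2))%N in ge1 ge2.
have L0 : (0 < L)%N by rewrite expn_gt0; lia.
have big := mul_expn_le 46 (e1 + e2) X1; rewrite -/L in big.
split=> [|rs r m r3 hm] /=.
  by apply: leq_trans (bitlen_binop _ _ _) _; lia.
have [u1 [m1 [r1 ht1 f1 v1]]] := IH1 rs r m r3 hm.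
have hm1 := holds_wider (leqnSn r) (holds_frame r3 f1 hm).
have [u2 [m2 [r2 ht2 f2 v2]]] := IH2 rs r.+1 m1 (leqW r3) hm1.
have w1 : m2 r 0%N = value inp off N v t1 by rewrite f2.
have [|u3 ht3 r3'] := @run_setreg L r (Bin o (reg r) (reg r.+1)) m2 L0.
  by rewrite /= v2 w1; apply/andP; split; lia.
exists (u1 + (u2 + u3))%N, (update m2 r 0%N (eval m2 (Bin o (reg r) (reg r.+1)))); split.
- exact: RunSeq r1 (RunSeq r2 r3').
- by move: ht3; rewrite /= bitlen0 => ht3; lia.
- exact: frame_trans f1 (frame_trans (frame_wider (leqnSn r) f2) (frame_update _ _ _)).
- by rewrite updateE /= v2 w1.
Qed.

Lemma computed_Let t1 t2 : computed t1 -> computed t2 -> computed (Let t1 t2).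
Proof.
move=> IH1 IH2 e0; have [e1 {}IH1] := IH1 e0; have [e2 {}IH2] := IH2 (e0 + e1)%N.
exists (46 + (e1 + e2))%N => X inp off N v X1 NX sm.
have [vb1 {}IH1] := IH1 _ _ _ _ _ X1 NX sm.
have sm' : small (X ^ (e0 + e1)) inp off (value inp off N v t1 :: v).
  have [hi ho hv] := small_le (expn_le X1 (leq_addr e1 e0)) sm.
  by split=> //=; rewrite hv andbT (leq_trans vb1) // expn_le // leq_addl.
have [vb2 {}IH2] := IH2 _ _ _ _ _ X1 NX sm'.
have ge1 : (X ^ e1 <= X ^ (e1 + e2))%N by rewrite expn_le // leq_addr.
have ge2 : (X ^ e2 <= X ^ (e1 + e2))%N by rewrite expn_le // leq_addl.
set L := (X ^ (e1 + e2))%N in ge1 ge2.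
have L0 : (0 < L)%N by rewrite expn_gt0; lia.
have big := mul_expn_le 46 (e1 + e2) X1; rewrite -/L in big.
split=> [|rs r m r3 hm] /=; first by lia.
have [u1 [m1 [r1 ht1 f1 v1]]] := IH1 rs r m r3 hm.
have hm1 : holds inp off N r.+1 (r :: rs) (value inp off N v t1 :: v) m1.
  have [h0 h2 h3 hv hr] := holds_wider (leqnSn r) (holds_frame r3 f1 hm).
  by split=> //=; [rewrite v1 hv|rewrite hr r3 ltnS leqnn].
have [u2 [m2 [r2 ht2 f2 v2]]] := IH2 _ r.+1 m1 (leqW r3) hm1.
have [|u3 ht3 r3'] := @run_setreg L r (reg r.+1) m2 L0.
  by rewrite /= v2; lia.
exists (u1 + (u2 + u3))%N, (update m2 r 0%N (eval m2 (reg r.+1))); split.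
- exact: RunSeq r1 (RunSeq r2 r3').
- by move: ht3; rewrite /= bitlen0 => ht3; lia.
- exact: frame_trans f1 (frame_trans (frame_wider (leqnSn r) f2) (frame_update _ _ _)).
- by rewrite updateE /= v2.
Qed.

Lemma computed_Pos t : computed t -> computed (Pos t).
Proof.
move=> IH e0; have [e1 {}IH] := IH e0.
exists (46 + e1)%N => X inp off N v X1 NX sm; have [vb {}IH] := IH _ _ _ _ _ X1 NX sm.
set L := (X ^ e1)%N in vb IH.
have L0 : (0 < L)%N by rewrite expn_gt0; lia.
have big := mul_expn_le 46 e1 X1; rewrite -/L in big.
have bb (b : bool) : bitlen (b : nat)%:Z = 2 by case: b.
split=> [|rs r m r3 hm] /=; first by rewrite bb; lia.
have [u1 [m1 [r1 ht1 f1 v1]]] := IH rs r m r3 hm.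
set b := (0 < value inp off N v t).
have [u2 ht2 r2] := @run_setreg L r (Const (b : nat)%:Z) m1 L0 isT.
have vb1 : reads_le L m1 (reg r) by apply: reads_reg; rewrite v1.
have [ht3 ht4] := expr_costP L0 vb1.
exists (u1 + (eval_time m1 (reg r) + bitlen (eval m1 (reg r)) + u2))%N,
  (update m1 r 0%N (eval m1 (Const (b : nat)%:Z))); split.
- apply: RunSeq r1 _; move: r2; have [pos|npos] := boolP b => r2.
    by apply: RunIfTrue => //=; rewrite v1.
  by apply: RunIfFalse => //=; rewrite v1 leNgt.
- by move: ht2 ht3 ht4; rewrite /= bb bitlen0; lia.
- exact: frame_trans f1 (frame_update _ _ _).
- by rewrite updateE.
Qed.

(** The common part of [Sum] and [Prd].  One step adds at most the length of the
    body to the length of the accumulator, whether it adds or multiplies, so that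
    [N <= X] steps gain one power of [X]. *)
Lemma computed_loop o z (F : term -> term) t : bitlen z = 2 ->
  (forall rs r, compile rs r (F t) =
     compile_loop o z r (compile (r.+1 :: rs) r.+2 t)) ->
  (forall inp off N v, value inp off N v (F t) =
     iteri N (fun i x => eval_binop o x (value inp off N (i%:Z :: v) t)) z) ->
  computed t -> computed (F t).
Proof.
move=> z2 hc hF IH e0.
(* The loop counter is one more variable, of length at most X ^ 2. *)
have [e1 {}IH] := IH (e0 + 2)%N.
exists (173 + (e1 + 3))%N => X inp off N v X1 NX sm.
have le02 : (X ^ e0 <= X ^ (e0 + 2))%N by rewrite expn_le // leq_addr.
have bi i : (i <= N)%N -> (bitlen i%:Z <= X ^ 2)%N.
  by move=> iN; apply: leq_trans (bitlen_nat _) _; rewrite expnS expn1; nia.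
have sm' i : (i < N)%N -> small (X ^ (e0 + 2)) inp off (i%:Z :: v).
  move=> iN; have [hi ho hv] := small_le le02 sm.
  by split=> //=; rewrite hv andbT (leq_trans (bi _ (ltnW iN))) // expn_le // leq_addl.
have {}IH i (iN : (i < N)%N) := IH _ _ _ _ _ X1 NX (sm' i iN).
set acc := fun n => iteri n (fun i x => eval_binop o x (value inp off N (i%:Z :: v) t)) z.
set L := (X ^ (e1 + 2))%N.
have L2 : (X ^ 2 <= L)%N by rewrite /L expn_le // leq_addl.
have L1 : (X ^ e1 <= L)%N by rewrite /L expn_le // leq_addr.
have accL n : (n <= N)%N -> (bitlen (acc n) <= L)%N.
  move=> nN; apply: (@leq_trans (n * X ^ e1 + 2)%N).
    elim: n nN => [|n IHn] nN; first by rewrite /acc /= z2.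
    rewrite /acc iteriS; apply: leq_trans (bitlen_binop _ _ _) _.
    by rewrite -/(acc n); have [bn _] := IH _ nN; have := IHn (ltnW nN); rewrite mulSn; lia.
  have E0 : (0 < X ^ e1)%N by rewrite expn_gt0; lia.
  have nX : (n * X ^ e1 <= X * X ^ e1)%N by rewrite leq_mul2r (leq_trans nN NX) orbT.
  have XE : (2 <= X * X ^ e1)%N by nia.
  by rewrite /L expnD (expnS X 1) expn1 mulnA mulnC [(_ * X)%N]mulnC; nia.
have L0 : (0 < L)%N by rewrite expn_gt0; lia.
have XL : (X ^ (e1 + 3) = X * L)%N by rewrite -expnS addnS.
have big := mul_expn_le 173 (e1 + 3) X1; rewrite XL in big.
rewrite hF -/(acc N).
split=> [|rs r m r3 hm]; first by apply: leq_trans (accL _ (leqnn _)) _; nia.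
have [t1 ht1 r1] := @run_setreg L r (Const z) m L0 isT.
set m1 := update m _ _ _ in r1.
have [t2 ht2 r2] := @run_setreg L r.+1 (Const 0) m1 L0 isT.
set m2 := update m1 _ _ _ in r2.
pose Inv i m' := [/\ (i <= N)%N, holds inp off N r.+2 (r.+1 :: rs) (i%:Z :: v) m',
  frame r m m' & m' r 0%N = acc i].
have testP i m' : Inv i m' -> eval m' (Bin Defs.Sub (reg 3) (reg r.+1)) = N%:Z - i%:Z /\
   (eval_time m' (Bin Defs.Sub (reg 3) (reg r.+1)) +
     bitlen (eval m' (Bin Defs.Sub (reg 3) (reg r.+1))) <= 40 * L)%N.
  move=> [iN [_ _ h3 [hi _] _] _ _]; split; first by rewrite /= h3 hi.
  have [|h1 h2] := @expr_costP L m' (Bin Defs.Sub (reg 3) (reg r.+1)) L0.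
    by rewrite /= h3 hi !(leq_trans (bi _ _) L2).
  by move: h1 h2; rewrite [expr_cost _]/= bitlen0; lia.
have [||| t3 [m3 [r3' ht3 [_ _ f3 v3]]]] := @run_for Inv
  (Bin Defs.Sub (reg 3) (reg r.+1))
  (Seq (compile (r.+1 :: rs) r.+2 t) (Seq (setreg r (Bin o (reg r) (reg r.+2)))
     (setreg r.+1 (Bin Defs.Add (reg r.+1) (Const 1))))) N (40 * L) (77 * L) _ _ m2.
- move=> i m' iN I; have [-> tle] := testP _ _ I; have [_ hm' fm' vm'] := I.
  split=> //; first by rewrite subr_gt0.
  have [bt {}IH] := IH i iN.
  have [u1 [k1 [s1 hu1 g1 w1]]] := IH _ _ _ (leqW (leqW r3)) hm'.
  have wr : k1 r 0%N = acc i by rewrite g1.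
  have wr1 : k1 r.+1 0%N = i by rewrite g1 //; case: hm' => _ _ _ [].
  have [|u2 hu2 s2] := @run_setreg L r (Bin o (reg r) (reg r.+2)) k1 L0.
    by rewrite /= w1 wr (accL _ (ltnW iN)) (leq_trans bt L1).
  set k2 := update k1 _ _ _ in s2.
  have wr2 : k2 r.+1 0%N = i by rewrite /k2 /update (gtn_eqF (ltnSn r)).
  have [|u3 hu3 s3] := @run_setreg L r.+1 (Bin Defs.Add (reg r.+1) (Const 1)) k2 L0.
    by rewrite /= wr2 (leq_trans (bi _ (ltnW iN)) L2).
  set k3 := update k2 _ _ _ in s3.
  have g3 : frame r m' k3.
    apply: frame_trans (frame_wider _ g1) _ => //; first by lia.
    exact: frame_trans (frame_update _ _ _) (frame_update _ _ (leqnSn _)).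
  exists (u1 + (u2 + u3))%N, k3; split.
  + exact: RunSeq s1 (RunSeq s2 s3).
  + by move: hu2 hu3; rewrite /= bitlen0 bitlen1; lia.
  + split=> //; last first.
      by rewrite /k3 /update (ltn_eqF (ltnSn r)) /k2 updateE /= wr w1.
    - exact: frame_trans fm' g3.
    have [h0 h2 h3 [hi hv] hr] := hm'.
    have hrs : all (fun q => 3 < q < r)%N rs by case: hm.
    split=> // [k|k||].
    + by rewrite g3 //; lia.
    + by rewrite g3 //; lia.
    + by rewrite g3.
    + rewrite /= {1}/k3 updateE /= wr2 -PoszD addn1 -hv; congr (_ :: _).
      by apply/eq_in_map => q /(allP hrs)/andP[_ qr]; apply: g3.
- move=> m' I; by have [-> tle] := testP _ _ I; split; first by rewrite subrr.
- have f2 : frame r m m2.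
    exact: frame_trans (frame_update _ _ _) (frame_update _ _ (leqnSn _)).
  split=> //; last by rewrite /m2 {1}/update (ltn_eqF (ltnSn r)) /= /m1 updateE.
  have [h0 h2 h3 hv hr] := holds_frame r3 f2 hm.
  split=> //=; first by rewrite {1}/m2 updateE hv.
  by apply/andP; split; [lia|apply/allP => q /(allP hr); lia].
exists (t1 + (t2 + t3))%N, m3; split=> //.
- by rewrite hc; exact: RunSeq r1 (RunSeq r2 r3').
- move: ht1 ht2 ht3; rewrite /= z2 bitlen0 -mulnDl => ht1 ht2 ht3.
  have NL : (N * L <= X * L)%N by rewrite leq_mul2r NX orbT.
  have XL1 : (L <= X * L)%N by rewrite leq_pmull //; lia.
  by rewrite mulnCA in ht3; lia.
Qed.

Lemma computed_Sum t : computed t -> computed (Sum t).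
Proof.
apply: (@computed_loop Defs.Add 0) => // inp off N v /=.
elim: {1 3}N => [|n IH]; first by rewrite big_geq.
by rewrite big_nat_recr //= IH.
Qed.

Lemma computed_Prd t : computed t -> computed (Prd t).
Proof.
apply: (@computed_loop Defs.Mul 1) => // inp off N v /=.
elim: {1 3}N => [|n IH]; first by rewrite big_geq.
by rewrite big_nat_recr //= IH.
Qed.

Lemma computedP t : computed t.
Proof.
elim: t => [z|k|t|t|o t1 IH1 t2|t|t|t|t1 IH1 t2].
- exact: computed_Cst.
- exact: computed_Arg.
- exact: computed_Inp.
- exact: computed_Off.
- exact: computed_Op.
- exact: computed_Pos.
- exact: computed_Sum.
- exact: computed_Prd.
- exact: computed_Let.
Qed.

(** * The layout of the input *)

Lemma nth_flatten_block (T : Type) (x0 : T) (ss : seq (seq T)) r d :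
  (d < size (nth [::] ss r))%N ->
  nth x0 (flatten ss) (sumn (take r (shape ss)) + d) = nth x0 (nth [::] ss r) d.
Proof.
elim: ss r => [|s ss IH] [|r] //=; first by rewrite add0n nth_cat => ->.
by move=> dr; rewrite -addnA nth_cat ltnNge leq_addr /= addKn IH.
Qed.

Section Layout.
Variable I : instance.
Local Notation n := (nitems I).

Definition blocks := [seq encode_item i | i <- enum 'I_n].

(** The number of items and the two budgets take the first 5 cells. *)
Definition item_pos k := (5 + sumn (take k (shape blocks)))%N.

Lemma size_encode_item (i : 'I_n) : size (encode_item i) = (7 + 4 * levels i)%N.
Proof.
rewrite /encode_item /= size_flatten /shape -map_comp.
rewrite (eq_map (g := fun=> 4)) // sumnE big_map big_const_seq count_predT.
by rewrite size_iota iter_addn_0; lia.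
Qed.

Lemma size_blocks : size blocks = n.
Proof. by rewrite size_map size_enum_ord. Qed.

Lemma size_encode : size (encode I) = item_pos n.
Proof.
rewrite /encode /= size_flatten -/blocks /item_pos take_oversize //.
by rewrite size_map size_blocks.
Qed.

Lemma nth_blocks (i : 'I_n) : nth [::] blocks i = encode_item i.
Proof. by rewrite (nth_map i) ?size_enum_ord // nth_ord_enum. Qed.

Definition input k : int := nth 0 (encode I) k.
Definition offset k : int := if (k < n)%N then (item_pos k)%:Z else 0.

Lemma input_item (i : 'I_n) d : (d < 7 + 4 * levels i)%N ->
  input (item_pos i + d) = nth 0 (encode_item i) d.
Proof.
by move=> di; rewrite -nth_blocks -nth_flatten_block ?nth_blocks ?size_encode_item.
Qed.

Lemma item_posS (i : 'I_n) : item_pos i.+1 = (item_pos i + (7 + 4 * levels i))%N.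
Proof.
rewrite /item_pos (take_nth 0%N); last by rewrite size_map size_blocks.
rewrite -cats1 sumn_cat /= addn0 addnA; congr (_ + _)%N.
by rewrite (nth_map [::]) ?nth_blocks ?size_encode_item ?size_blocks.
Qed.

Lemma item_pos0 : item_pos 0 = 5. Proof. by rewrite /item_pos take0. Qed.

Lemma item_pos_le k : (item_pos k <= size (encode I))%N.
Proof.
rewrite size_encode /item_pos leq_add2l [take n _]take_oversize;
  last by rewrite size_map size_blocks.
by rewrite -{2}(cat_take_drop k (shape blocks)) sumn_cat leq_addr.
Qed.

Lemma nitems_le : (n + 5 <= size (encode I))%N.
Proof.
suff h k : (k <= n)%N -> (k + 5 <= item_pos k)%N by rewrite size_encode h.
elim: k => [|k IH] kn; first by rewrite item_pos0.
by have := IH (ltnW kn); rewrite (item_posS (Ordinal kn)) /=; lia.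
Qed.

Lemma levels_le (i : 'I_n) : (levels i + 5 < size (encode I))%N.
Proof. by have := item_pos_le i.+1; rewrite item_posS /item_pos; lia. Qed.

Lemma input_levels (i : 'I_n) : input (item_pos i) = levels i.
Proof. by rewrite -[item_pos i]addn0 input_item. Qed.

Lemma size_encode_le : ((size (encode I)).*2 <= input_size I)%N.
Proof.
rewrite /input_size -muln2 mulnC.
by rewrite -[size _]sum1_size big_distrr leq_sum.
Qed.

Lemma bitlen_input k : (bitlen (input k) <= (input_size I).+2)%N.
Proof.
rewrite /input; have [kl|kl] := ltnP k (size (encode I)); last by rewrite nth_default.
rewrite /input_size (big_nth 0) big_mkord (bigD1 (Ordinal kl)) //=; lia.
Qed.

Lemma bitlen_offset k : (bitlen (offset k) <= (input_size I).+2)%N.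
Proof.
rewrite /offset; case: ifP => _ //.
by apply: leq_trans (bitlen_nat _) _; have := item_pos_le k; have := size_encode_le; lia.
Qed.

End Layout.

(** * Reading the input and writing the output *)

(** The length of an item depends on its number of levels, so the items have to
    be located one after the other.  The running position, in array 3, ends up
    being the length of the input, which bounds the number of items and all
    numbers of levels: it serves as the range of all later loops. *)
Definition prelude :=
  Seq (setreg 3 (Const 5)) (Seq (setreg 4 (Const 0))
    (While (Bin Defs.Sub (reg 0) (reg 4))
      (Seq (Set_ 2 (reg 4) (reg 3))
      (Seq (setreg 3 (Bin Defs.Add (reg 3)
              (Bin Defs.Add (Const 7) (Bin Defs.Mul (Const 4) (Get 0 (reg 3))))))
           (setreg 4 (Bin Defs.Add (reg 4) (Const 1))))))).

Lemma bitlen_le_size I k : (k <= size (encode I))%N ->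
  (bitlen k%:Z <= (input_size I).+2)%N.
Proof.
by move=> kN; apply: leq_trans (bitlen_nat _) _; have := size_encode_le I; lia.
Qed.

Lemma preludeP : exists e, forall I,
  exists t m, [/\ run prelude (input_memory I) t m,
    (t <= (input_size I).+2 ^ e)%N, m 0%N =1 input I, m 2%N =1 offset I
  & m 3%N 0%N = size (encode I)].
Proof.
exists (500 + 2)%N => I; set L := (input_size I).+2.
have L0 : (0 < L)%N by [].
have L5 : (bitlen 5 <= L)%N by apply: (bitlen_le_size (k := 5)); have := nitems_le I; lia.
pose m0 := input_memory I.
have [t1 ht1 r1] := @run_setreg L 3 (Const 5) m0 L0 isT.
set m1 := update m0 _ _ _ in r1.
have [t2 ht2 r2] := @run_setreg L 4 (Const 0) m1 L0 isT.
set m2 := update m1 _ _ _ in r2.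
pose Inv i (m : memory) := [/\ (i <= nitems I)%N, m 0%N =1 input I,
  forall k, m 2%N k = if (k < i)%N then (item_pos I k)%:Z else 0,
  m 3%N 0%N = item_pos I i & m 4 0%N = i%:Z].
have bi i : (i <= nitems I)%N -> (bitlen i%:Z <= L)%N.
  by move=> iN; apply: bitlen_le_size; have := nitems_le I; lia.
have bp i : (bitlen (item_pos I i)%:Z <= L)%N by apply/bitlen_le_size/item_pos_le.
have testP i m : Inv i m ->
   eval m (Bin Defs.Sub (reg 0) (reg 4)) = (nitems I)%:Z - i%:Z /\
   (eval_time m (Bin Defs.Sub (reg 0) (reg 4)) +
     bitlen (eval m (Bin Defs.Sub (reg 0) (reg 4))) <= 40 * L)%N.
  move=> [iN h0 h2 h3 h4]; split; first by rewrite /= h0 h4.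
  have [|h5 h6] := @expr_costP L m (Bin Defs.Sub (reg 0) (reg 4)) L0.
    by rewrite /= h0 h4 (bi i iN) (bi _ (leqnn _)).
  by move: h5 h6; rewrite [expr_cost _]/= bitlen0; lia.
have [||| t3 [m3 [r3 ht3 [_ f0 f2 f3 f4]]]] := @run_for Inv
  (Bin Defs.Sub (reg 0) (reg 4)) (Seq (Set_ 2 (reg 4) (reg 3))
      (Seq (setreg 3 (Bin Defs.Add (reg 3)
              (Bin Defs.Add (Const 7) (Bin Defs.Mul (Const 4) (Get 0 (reg 3))))))
           (setreg 4 (Bin Defs.Add (reg 4) (Const 1))))) (nitems I) (40 * L) (400 * L) _ _ m2.
- move=> i m iN Im; have [-> tle] := testP _ _ Im; have [_ h0 h2 h3 h4] := Im.
  split=> //; first by rewrite subr_gt0.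
  have [||u1 hu1 s1] := @run_set L 2 (reg 4) (reg 3) m L0.
  + by rewrite /= h4 (bi _ (ltnW iN)).
  + by rewrite /= h3 bp.
  set k1 := update m _ _ _ in s1.
  have [|u2 hu2 s2] := @run_setreg L 3 (Bin Defs.Add (reg 3)
              (Bin Defs.Add (Const 7) (Bin Defs.Mul (Const 4) (Get 0 (reg 3))))) k1 L0.
    by rewrite /= /k1 /update /= h3 h0 bp bitlen_input.
  set k2 := update k1 _ _ _ in s2.
  have [|u3 hu3 s3] := @run_setreg L 4 (Bin Defs.Add (reg 4) (Const 1)) k2 L0.
    by rewrite /= /k2 /k1 /update /= h4 (bi _ (ltnW iN)).
  exists (u1 + (u2 + u3))%N, (update k2 4 0 (eval k2 (Bin Defs.Add (reg 4) (Const 1)))); split.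
  + exact: RunSeq s1 (RunSeq s2 s3).
  + have e7 : bitlen 7 = 4 by [].
    have e4 : bitlen 4 = 4 by [].
    by move: hu1 hu2 hu3; rewrite /= e7 e4 bitlen1 bitlen0; lia.
  + split=> // [k||].
    * rewrite /update /= /k2 /update /= /k1 /update /= h4 absz_nat h2 h3 ltnS [(k <= i)%N]leq_eqVlt.
      by case: eqP => [->|].
    * rewrite /update /= /k2 /update /= /k1 /update /= h3 absz_nat h0 (input_levels (Ordinal iN)).
      by rewrite (item_posS (Ordinal iN)) /=; lia.
    * by rewrite updateE /= /k2 /k1 /update /= h4; lia.
- by move=> m Im; have [-> tle] := testP _ _ Im; split; first by rewrite subrr.
- by split=> //; rewrite item_pos0.
exists (t1 + (t2 + t3))%N, m3; split=> //.
- exact: RunSeq r1 (RunSeq r2 r3).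
- have e5 : bitlen 5 = 4 by [].
  have nL : (nitems I * L <= L ^ 2)%N.
    rewrite expnS expn1 leq_mul2r; have := nitems_le I; have := size_encode_le I.
    by rewrite /L; lia.
  have LL : (L <= L ^ 2)%N by rewrite expnS expn1 leq_pmulr.
  apply: leq_trans (mul_expn_le 500 2 (isT : (1 < L)%N)).
  move: (L ^ 2)%N LL nL => L' LL nL.
  move: ht1 ht2 ht3; rewrite /= e5 bitlen0 -mulnDl mulnCA; lia.
- by rewrite f3 size_encode.
Qed.

Definition tabulate t :=
  Seq (setreg 4 (Const 0))
    (While (Bin Defs.Sub (reg 3) (reg 4))
      (Seq (compile [:: 4] 5 t)
      (Seq (Set_ 1 (reg 4) (reg 5))
           (setreg 4 (Bin Defs.Add (reg 4) (Const 1)))))).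

Lemma tabulateP t : exists e, forall I m,
  m 0%N =1 input I -> m 2%N =1 offset I -> m 3%N 0%N = size (encode I) ->
  exists tm m', [/\ run (tabulate t) m tm m', (tm <= (input_size I).+2 ^ e)%N
  & forall k, (k < size (encode I))%N ->
      m' 1%N k = value (input I) (offset I) (size (encode I)) [:: k%:Z] t].
Proof.
have [e0 ct] := computedP t 1.
exists (400 + e0.+2)%N => I m0 i0 i2 i3; set X := (input_size I).+2.
set L := (X ^ e0.+1)%N; set N := size _; pose v k := value (input I) (offset I) N [:: Posz k] t.
have XL : (X <= L)%N by rewrite /L expnS leq_pmulr ?expn_gt0.
have L0 : (0 < L)%N by apply: leq_trans XL.
have L1 : (X ^ e0 <= L)%N by rewrite expn_le.
have NX : (N <= X)%N by have := size_encode_le I; rewrite /X /N; lia.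
have bi i : (i <= N)%N -> (bitlen i%:Z <= X)%N by exact: bitlen_le_size.
have {}ct i (iN : (i < N)%N) := ct X (input I) (offset I) N [:: i%:Z] isT NX.
have sm i : (i < N)%N -> small (X ^ 1) (input I) (offset I) [:: i%:Z].
  move=> iN; rewrite expn1; split=> [k|k|]; [exact: bitlen_input|exact: bitlen_offset|].
  by rewrite /= bi // ltnW.
have {}ct i (iN : (i < N)%N) := ct i iN (sm i iN).
have [t1 ht1 r1] := @run_setreg L 4 (Const 0) m0 L0 isT.
set m1 := update m0 _ _ _ in r1.
pose Inv i (m : memory) := [/\ (i <= N)%N, holds (input I) (offset I) N 5 [:: 4] [:: i%:Z] m
  & forall k, (k < i)%N -> m 1%N k = v k].
have testP i m : Inv i m -> eval m (Bin Defs.Sub (reg 3) (reg 4)) = N%:Z - i%:Z /\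
   (eval_time m (Bin Defs.Sub (reg 3) (reg 4)) +
     bitlen (eval m (Bin Defs.Sub (reg 3) (reg 4))) <= 40 * L)%N.
  move=> [iN [_ _ h3 [h4] _] _]; split; first by rewrite /= h3 h4.
  have [|h5 h6] := @expr_costP L m (Bin Defs.Sub (reg 3) (reg 4)) L0.
    by rewrite /= h3 h4 !(leq_trans (bi _ _) XL).
  by move: h5 h6; rewrite [expr_cost _]/= bitlen0; lia.
have [||| t3 [m3 [r3 ht3 [_ _ f1]]]] := @run_for Inv
  (Bin Defs.Sub (reg 3) (reg 4)) (Seq (compile [:: 4] 5 t)
      (Seq (Set_ 1 (reg 4) (reg 5))
           (setreg 4 (Bin Defs.Add (reg 4) (Const 1))))) N (40 * L) (200 * L) _ _ m1.
- move=> i m iN Im; have [-> tle] := testP _ _ Im; have [_ hm h1] := Im.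
  split=> //; first by rewrite subr_gt0.
  have [bt {}ct] := ct i iN.
  have [u1 [k1 [s1 hu1 g1 w1]]] := ct [:: 4] 5 m isT hm.
  have [h0 h2 h3 [h4] _] := hm.
  have w4 : k1 4 0%N = i%:Z by rewrite g1.
  have [||u2 hu2 s2] := @run_set L 1 (reg 4) (reg 5) k1 L0.
  + by rewrite /= w4 (leq_trans (bi _ (ltnW iN)) XL).
  + by rewrite /= w1 (leq_trans bt L1).
  set k2 := update k1 _ _ _ in s2.
  have [|u3 hu3 s3] := @run_setreg L 4 (Bin Defs.Add (reg 4) (Const 1)) k2 L0.
    by rewrite /= /k2 /update /= w4 (leq_trans (bi _ (ltnW iN)) XL).
  exists (u1 + (u2 + u3))%N, (update k2 4 0 (eval k2 (Bin Defs.Add (reg 4) (Const 1)))); split.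
  + exact: RunSeq s1 (RunSeq s2 s3).
  + by move: hu2 hu3; rewrite /= bitlen1 bitlen0; lia.
  + split=> // [|k ki].
      split=> // [k|k||]; rewrite /update /= /k2 /update /= ?g1 //.
      by rewrite h4; congr [:: _]; lia.
    rewrite /update /= /k2 /update /= w4 absz_nat w1; move: ki; rewrite ltnS leq_eqVlt.
    by case: eqP => [->|_ ki] //; rewrite g1 // h1.
- by move=> m Im; have [-> tle] := testP _ _ Im; split; first by rewrite subrr.
- by split=> //; split=> // k; rewrite /update /= ?i0 ?i2.
exists (t1 + t3)%N, m3; split=> //; first exact: RunSeq r1 r3.
have big := @mul_expn_le X 400 e0.+2 isT.
have XLE : (X ^ e0.+2 = X * L)%N by rewrite /L -expnS.
have NL : (N * L <= X * L)%N by rewrite leq_mul2r NX orbT.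
have XL1 : (L <= X * L)%N by rewrite leq_pmull.
rewrite XLE in big.
by move: ht1 ht3; rewrite /= bitlen0 -mulnDl mulnCA; lia.
Qed.

(** * The greedy choice under two budgets *)

Section Density.
Variables (n : nat) (p s : 'I_n -> int).

(** Smaller ratio size / profit, ties being broken by the index so that the order
    is total and the cumulated size grows by one item at a time. *)
Definition denser i h := (s i * p h < s h * p i) ||
  (s i * p h <= s h * p i) && (i < h)%N.

(** Any [h >= n] stands for the initial segment containing all items. *)
Definition in_prefix (h : nat) i := if insub h is Some h' then denser i h' else true.

Variables (E : {set 'I_n}) (K : int).
Hypothesis p_gt0 : {in E, forall i, 0 < p i}.
Hypothesis s_ge0 : {in E, forall i, 0 <= s i}.
Hypothesis K_gt0 : 0 < K.

Lemma ratio_trans x y z : x \in E -> y \in E -> z \in E ->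
  s x * p y <= s y * p x -> s y * p z <= s z * p y -> s x * p z <= s z * p x.
Proof.
move=> /p_gt0 px /p_gt0 py /p_gt0 pz xy yz; rewrite -(ler_pM2l py).
have h1 : s x * p y * p z <= s y * p x * p z by rewrite ler_pM2r.
have h2 : s y * p z * p x <= s z * p y * p x by rewrite ler_pM2r.
by lia.
Qed.

Lemma denser_irr x : denser x x = false.
Proof. by rewrite /denser ltxx ltnn andbF. Qed.

Lemma denser_trans x y z : x \in E -> y \in E -> z \in E ->
  denser x y -> denser y z -> denser x z.
Proof.
move=> xE yE zE; have h1 := ratio_trans xE yE zE; have h2 := ratio_trans zE xE yE.
have h3 := ratio_trans yE zE xE.
by rewrite /denser; lia.
Qed.

Lemma denser_total x y : x != y -> denser x y || denser y x.
Proof. by rewrite /denser -val_eqE /=; lia. Qed.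

(** The item at which the cumulated size reaches [K].  It is obtained without
    sorting, as the one with the shortest closed initial segment of size at least
    [K]: if the open segment were still of size at least [K], its last item would
    do better. *)
Lemma density_split : K <= \sum_(i in E) s i ->
  exists2 h, h \in E & \sum_(i in E | denser i h) s i < K /\
    K <= \sum_(i in E | (i == h) || denser i h) s i.
Proof.
move=> big.
pose F h := [set i in E | (i == h) || denser i h].
have sumF h : \sum_(i in E | (i == h) || denser i h) s i = \sum_(i in F h) s i.
  by apply: eq_bigl => i; rewrite inE.
(* The last item of D, as the one with the largest initial segment. *)
have pick (D : {set 'I_n}) : D \subset E -> K <= \sum_(i in D) s i ->
    exists2 h, h \in D & D \subset F h.
  move=> DE KD; have [i0 i0D] : exists i, i \in D.
    apply/set0Pn; apply: contraTneq KD => ->; by rewrite big_set0 -ltNge.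
  case: (@arg_maxnP _ i0 (mem D) (fun h => #|F h|) i0D) => h hD hmax; exists h => //.
  apply/subsetP => i iD; have iE := subsetP DE _ iD; have hE := subsetP DE _ hD.
  rewrite inE iE /=; apply: contraT; rewrite negb_or => /andP[ih nih].
  have hi : denser h i by have := denser_total ih; rewrite (negPf nih).
  have : (#|F h| < #|F i|)%N.
    apply/proper_card/properP; split; last first.
      by exists i; rewrite !inE iE ?eqxx //= negb_or ih nih.
    apply/subsetP => j; rewrite !inE => /andP[jE jh]; rewrite jE /=.
    case/predU1P: jh => [->|jh].
      by rewrite hi orbT.
    by rewrite (denser_trans jE hE iE jh hi) orbT.
  by rewrite ltnNge => /negP; case; apply: hmax.
have [h0 h0E sub0] := pick E (subxx _) big.
have K0 : K <= \sum_(i in F h0) s i.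
  suff -> : F h0 = E by [].
  by apply/eqP; rewrite eqEsubset sub0 andbT; apply/subsetP => i; rewrite inE => /andP[].
pose P h := (h \in E) && (K <= \sum_(i in F h) s i).
have P0 : P h0 by rewrite /P h0E.
case: (@arg_minnP _ h0 P (fun h => #|F h|) P0) => h /andP[hE Kh] hmin.
exists h => //; rewrite sumF; split=> //; rewrite ltNge; apply/negP => Kbad.
pose D := [set i in E | denser i h].
have DE : D \subset E by apply/subsetP => i; rewrite inE => /andP[].
have KD : K <= \sum_(i in D) s i.
  apply: le_trans Kbad _; rewrite le_eqVlt; apply/predU1P; left.
  by apply: eq_bigl => i; rewrite inE.
have [k kD Dk] := pick D DE KD.
have kE := subsetP DE _ kD; have kh : denser k h by move: kD; rewrite inE => /andP[].
have Pk : P k.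
  rewrite /P kE; apply: le_trans KD _.
  rewrite [leRHS](big_setID D) /= (setIidPr Dk) lerDl.
  by apply: sumr_ge0 => i; rewrite !inE => /andP[_ /andP[iE _]]; apply: s_ge0.
have := hmin k Pk; rewrite leqNgt => /negP; apply.
apply/proper_card/properP; split; last first.
  exists h; rewrite !inE hE ?eqxx //= negb_or; apply/andP; split.
    by apply: contraTneq kh => ->; rewrite denser_irr.
  by apply/negP => hk; have := denser_trans hE kE hE hk kh; rewrite denser_irr.
apply/subsetP => j; rewrite !inE => /andP[jE jk]; rewrite jE /=.
case/predU1P: jk => [->|jk].
  by rewrite kh orbT.
by rewrite (denser_trans jE kE hE jk kh) orbT.
Qed.

(** Half of the fractional relaxation: let [F] be the segment closed by [h], of
    size at least [K].  Passing from [F] to [T] exchanges items of [F] for items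
    with a ratio at least that of [h], so the profit increases by at most the
    increase in size divided by this ratio; the increase in size is less than
    [K], and [K] divided by the ratio is at most the profit of [F].  Dropping [h]
    from [F] costs at most [q].  If all of [E] has size less than [K], there is
    no such [h], and [E] itself is the segment. *)
Lemma prefix_half (T : {set 'I_n}) (q : int) : T \subset E -> 0 <= q ->
  {in E, forall i, p i <= q} -> \sum_(i in T) s i < K * 2 ->
  exists h, [/\ (h <= n)%N, \sum_(i in E | in_prefix h i) s i < K
    & \sum_(i in T) p i <= 2 * (\sum_(i in E | in_prefix h i) p i + q)].
Proof.
move=> TE q0 pq sT; have [small|big] := ltP (\sum_(i in E) s i) K.
  have all_in : in_prefix n =1 xpredT by move=> i; rewrite /in_prefix insubN // ltnn.
  have sumE (f : 'I_n -> int) : \sum_(i in E | in_prefix n i) f i = \sum_(i in E) f i :> int.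
    by apply: eq_bigl => i; rewrite all_in andbT.
  exists n; rewrite !sumE; split=> //.
  have : \sum_(i in T) p i <= \sum_(i in E) p i.
    rewrite [leRHS](big_setID T) /= (setIidPr TE) lerDl.
    by apply: sumr_ge0 => i; rewrite !inE => /andP[_ /p_gt0/ltW].
  have : 0 <= \sum_(i in E) p i by apply: sumr_ge0 => i /p_gt0/ltW.
  by lia.
have [h hE [lt ge]] := density_split big.
have preE : in_prefix h =1 denser^~ h by move=> i; rewrite /in_prefix valK.
have sumE (f : 'I_n -> int) :
    \sum_(i in E | in_prefix h i) f i = \sum_(i in E | denser i h) f i :> int.
  by apply: eq_bigl => i; rewrite preE.
exists h; rewrite !sumE; split=> //; first exact: ltnW.
set A := \sum_(i in E | denser i h) p i.
pose F i := (i == h) || denser i h.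
have PF : \sum_(i in E | F i) p i = A + p h.
  rewrite (bigD1 h) /=; last by rewrite hE /F eqxx.
  rewrite addrC; congr (_ + _); apply: eq_bigl => i; rewrite /F.
  by case: eqP => [->|_] /=; rewrite ?andbT ?denser_irr ?andbF.
have ph := p_gt0 hE.
(* Termwise: whether an item of F is given up or an item outside of F is taken,
   its ratio compares with that of h in the direction needed. *)
have key : s h * (\sum_(i in T) p i - \sum_(i in E | F i) p i) <=
           p h * (\sum_(i in T) s i - \sum_(i in E | F i) s i).
  have mk (f : 'I_n -> int) : \sum_(i in T) f i - \sum_(i in E | F i) f i =
      \sum_(i in E) (((i \in T) : nat)%:Z - (F i : nat)%:Z) * f i.
    rewrite big_mkcondr /= (eq_bigl (fun i => (i \in E) && (i \in T))); last first.
      by move=> i; case: (boolP (i \in T)) => [/(subsetP TE)->|]; rewrite ?andbF.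
    rewrite big_mkcondr /= -sumrB; apply: eq_bigr => i _.
    by case: (i \in T); case: (F i); rewrite /= ?(subr0, subrr, sub0r, mul1r, mul0r, mulN1r).
  rewrite !mk !mulr_sumr; apply: ler_sum => i iE.
  have : if F i then s i * p h <= s h * p i else s h * p i <= s i * p h.
    rewrite /F /denser; case: eqP => [->|/eqP ih] //=.
    by case: ifP; lia.
  by case: (i \in T); case: (F i); lia.
have Fh : p h * \sum_(i in E | F i) s i <= s h * \sum_(i in E | F i) p i.
  rewrite !mulr_sumr; apply: ler_sum => i /andP[iE].
  by rewrite /F /denser => /predU1P[->|]; lia.
have sh := s_ge0 hE.
suff : \sum_(i in T) p i <= 2 * \sum_(i in E | F i) p i by rewrite PF; have := pq h hE; lia.
rewrite leNgt; apply/negP => bad.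
have h1 : s h * (2 * \sum_(i in E | F i) p i) <= s h * \sum_(i in T) p i.
  by rewrite ler_wpM2l // ltW.
have h2 : p h * (\sum_(i in T) s i) < p h * (2 * \sum_(i in E | F i) s i).
  by rewrite ltr_pM2l //; move: sT ge; rewrite /F; lia.
by lia.
Qed.

End Density.

Section Greedy.
(* [load], [gain] and [fits] concern level assignments: [a i] is 0 if item i is
   left out, and the level of item i plus one otherwise. *)
Variables (n : nat) (J : 'I_n -> nat) (p : 'I_n -> int) (w c : 'I_n -> nat -> int).
Variables (B C : int).

Definition load (f : 'I_n -> nat -> int) (a : 'I_n -> nat) : int :=
  \sum_(i | (0 < a i)%N) f i (a i).-1.
Definition gain (a : 'I_n -> nat) : int := \sum_(i | (0 < a i)%N) p i.
Definition fits a := (load w a <= B) && (load c a <= C).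

(** With integral data, total weight and cost [W < b] and [V < d] for
    [b = B + 1 - w g l] and [d = C + 1 - c g l] mean that the budgets left by [g]
    are respected.  The increment by one keeps both coefficients positive even if
    a budget is exhausted, and turns [W d + V b < b d] into a sufficient
    condition. *)
Definition surrogate g l i k : int :=
  w i k * (C + 1 - c g l) + c i k * (B + 1 - w g l).

Variable cheapest : 'I_n -> nat -> 'I_n -> nat.

Definition admits g l h i :=
  (0 < p i <= p g) && in_prefix p (fun i => surrogate g l i (cheapest g l i)) h i.

Definition greedy g l h i : nat :=
  if i == g then l.+1 else if admits g l h i then (cheapest g l i).+1 else 0%N.

Hypothesis p_ge0 : forall i, 0 <= p i.
Hypothesis w_ge0 : forall i k, (k <= J i)%N -> 0 <= w i k.
Hypothesis c_ge0 : forall i k, (k <= J i)%N -> 0 <= c i k.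
Hypothesis cheapest_le : forall g l i, (cheapest g l i <= J i)%N.
Hypothesis cheapest_min : forall g l i k, (k <= J i)%N ->
  surrogate g l i (cheapest g l i) <= surrogate g l i k.

Lemma greedy_sum (f : 'I_n -> nat -> int) g l h :
  \sum_(i | (0 < greedy g l h i)%N) f i (greedy g l h i).-1 =
  f g l + \sum_(i in [set i | (i != g) && (0 < p i <= p g)] |
      in_prefix p (fun i => surrogate g l i (cheapest g l i)) h i) f i (cheapest g l i).
Proof.
rewrite (bigD1 g) /=; last by rewrite /greedy eqxx.
rewrite {1}/greedy eqxx /=; congr (_ + _).
have eqA i : (0 < greedy g l h i)%N && (i != g) = (i != g) && admits g l h i.
  by rewrite /greedy; case: eqP => //= _; case: ifP.
rewrite (eq_bigl _ _ eqA); apply: eq_big => [i|i /andP[/negPf ig ad]].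
  by rewrite inE /admits andbA.
by rewrite /greedy ig ad.
Qed.

(** [g] is the most profitable item of [a] and [l] its level in [a].  The rest of
    [a] has surrogate size at most [(b - 1) d + (d - 1) b < 2 b d], also after
    moving each of its items to its cheapest level. *)
Theorem greedy_third a : (forall i, a i <= (J i).+1)%N -> fits a -> 0 < gain a ->
  exists g l h, [/\ (l <= J g)%N, (h <= n)%N, fits (greedy g l h)
    & gain a <= 3 * gain (greedy g l h)].
Proof.
move=> aJ /andP[aB aC] a0.
have [i0 ai0] : exists i, (0 < a i)%N.
  apply/existsP; apply: contraTT a0; rewrite negb_exists => /forallP none.
  by rewrite /gain big_pred0 // => i; apply/negbTE.
case: (@Order.TotalTheory.arg_maxP _ _ _ i0 (fun i => 0 < a i)%N p ai0) => g ag gmax.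
have alv i : (0 < a i)%N -> ((a i).-1 <= J i)%N by have := aJ i; lia.
pose l := (a g).-1; pose b := B + 1 - w g l; pose d := C + 1 - c g l.
have lJ : (l <= J g)%N := alv _ ag.
pose E := [set i | (i != g) && (0 < p i <= p g)].
pose T := [set i in E | (0 < a i)%N].
have TE : T \subset E by apply/subsetP => i; rewrite inE => /andP[].
have rest (f : 'I_n -> nat -> int) : (forall i k, (k <= J i)%N -> 0 <= f i k) ->
    f g l + \sum_(i in T) f i (a i).-1 <= load f a.
  move=> f0; rewrite /load [leRHS](bigD1 g) //= lerD2l.
  rewrite [leRHS](bigID (mem E)) /= ler_wpDr //.
    by apply: sumr_ge0 => i /andP[/andP[ai _] _]; apply/f0/alv.
  rewrite le_eqVlt; apply/predU1P; left; apply: eq_bigl => i; rewrite !inE.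
  by case: (i != g); rewrite ?andbF //= andbT andbC.
have W := le_trans (rest w w_ge0) aB; have Cc := le_trans (rest c c_ge0) aC.
have T_ge0 (f : 'I_n -> nat -> int) : (forall i k, (k <= J i)%N -> 0 <= f i k) ->
    0 <= \sum_(i in T) f i (a i).-1.
  by move=> f0; apply: sumr_ge0 => i; rewrite inE => /andP[_ /alv]; apply: f0.
have WT0 := T_ge0 w w_ge0; have CT0 := T_ge0 c c_ge0.
have b1 : 1 <= b by rewrite /b; lia.
have d1 : 1 <= d by rewrite /d; lia.
have sE i k : surrogate g l i k = w i k * d + c i k * b by [].
have s_ge0 : {in E, forall i, 0 <= surrogate g l i (cheapest g l i)}.
  move=> i _; rewrite sE; have := w_ge0 (cheapest_le g l i); have := c_ge0 (cheapest_le g l i).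
  by nia.
have pE : {in E, forall i, 0 < p i} by move=> i; rewrite inE => /and3P[].
have pq : {in E, forall i, p i <= p g} by move=> i; rewrite inE => /and3P[].
have K0 : 0 < b * d by nia.
have sT : \sum_(i in T) surrogate g l i (cheapest g l i) < b * d * 2.
  apply: (@le_lt_trans _ _ (\sum_(i in T) (w i (a i).-1 * d + c i (a i).-1 * b))).
    apply: ler_sum => i; rewrite inE => /andP[_ ai]; rewrite -sE.
    exact/cheapest_min/alv.
  rewrite big_split /= -!mulr_suml; move: W Cc WT0 CT0; rewrite -/l.
  set x := \sum_(i in T) w _ _; set y := \sum_(i in T) c _ _ => W Cc WT0 CT0.
  have xb : x <= b - 1 by rewrite /b; lia.
  have yd : y <= d - 1 by rewrite /d; lia.
  by nia.
have [h [hn sA pT]] := prefix_half pE s_ge0 K0 TE (p_ge0 g) pq sT.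
exists g, l, h; split=> //.
  rewrite /fits /load !greedy_sum -/E; move: sA.
  under eq_bigr do rewrite sE.
  rewrite big_split /= -!mulr_suml.
  have A_ge0 (f : 'I_n -> nat -> int) : (forall i k, (k <= J i)%N -> 0 <= f i k) ->
    0 <= \sum_(i in E | in_prefix p (fun i => surrogate g l i (cheapest g l i)) h i)
       f i (cheapest g l i).
    by move=> f0; apply: sumr_ge0 => i _; apply/f0/cheapest_le.
  move: (A_ge0 w w_ge0) (A_ge0 c c_ge0).
  set x := \sum_(i in E | _) w _ _; set y := \sum_(i in E | _) c _ _ => x0 y0 xy.
  have xb : x < b by nia.
  have yd : y < d by nia.
  by move: xb yd; rewrite /b /d; lia.
have -> : gain a = p g + \sum_(i in T) p i.
  rewrite /gain (bigD1 g) //=; congr (_ + _).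
  rewrite [LHS](bigID (fun i => 0 < p i)) /= addrC big1 ?add0r.
    apply: eq_bigl => i; rewrite !inE; case: (boolP (0 < a i)%N) => ai; rewrite ?andbF //=.
    have -> : p i <= p g by exact: gmax.
    by rewrite !andbT.
  by move=> i /andP[_]; rewrite -leNgt => pi; apply/le_anti; rewrite pi p_ge0.
have -> : gain (greedy g l h) = p g + \sum_(i in E |
   in_prefix p (fun i => surrogate g l i (cheapest g l i)) h i) p i.
  exact: (greedy_sum (fun i _ => p i)).
have arith (x y q : int) : 0 <= y -> x <= 2 * (y + q) -> q + x <= 3 * (q + y) by lia.
by apply: arith pT; apply: sumr_ge0 => i _.
Qed.

End Greedy.

(** * Truth values and search by terms *)

Notation tadd := (Op Defs.Add).
Notation tsub := (Op Defs.Sub).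
Notation tmul := (Op Defs.Mul).
Notation tdiv := (Op Defs.Div).
Notation tand := (Op Defs.Mul).

(* Truth values are 0 and 1, so that multiplication is both the conjunction and
   the restriction of a value to a case. *)
Definition tnot a := tsub (Cst 1) a.
Definition tor a b := tnot (tand (tnot a) (tnot b)).
Definition timp a b := tnot (tand a (tnot b)).
Definition tlt a b := Pos (tsub b a).
Definition tle a b := tnot (tlt b a).
Definition teq a b := tand (tle a b) (tle b a).
Definition tif c a b := tadd (tmul c a) (tmul (tnot c) b).
Definition tall := Prd.
Definition tex t := Pos (Sum t).

(** The first index satisfying [t] is the number of indices [j] such that no
    index up to [j] satisfies [t].  In [t], [Arg 0] is the candidate, [Arg 1] is
    [j], and the surrounding variables are shifted by 2. *)
Definition tfirst t := Sum (tall (tnot (tand (tle (Arg 0) (Arg 1)) t))).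

Definition b2z (b : bool) : int := (b : nat)%:Z.

Lemma find_iota P n k : (find P (iota 0 n) <= k)%N = (n <= k)%N || has P (iota 0 k.+1).
Proof.
have [nk|kn] := leqP n k.
  by rewrite (leq_trans (find_size _ _)) // size_iota.
apply/idP/hasP => [h|[j]].
  have hp : has P (iota 0 n) by rewrite has_find size_iota (leq_ltn_trans h).
  exists (find P (iota 0 n)); first by rewrite mem_iota.
  by have := nth_find 0%N hp; rewrite nth_iota ?add0n // -[X in (_ < X)%N](size_iota 0) -has_find.
rewrite mem_iota add0n /= ltnS => jk Pj; rewrite leqNgt; apply/negP => kf.
have := before_find 0%N (leq_ltn_trans jk kf).
by rewrite nth_iota ?add0n ?Pj //; apply: leq_ltn_trans kn.
Qed.

Section Logic.
Variables (inp off : nat -> int) (N : nat).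
Local Notation ev := (value inp off N).

Lemma ev_not v a p : ev v a = b2z p -> ev v (tnot a) = b2z (~~ p).
Proof. by move=> /= ->; case: p. Qed.

(** The second factor may be meaningless, for instance read outside of the
    instance, when the first one is 0. *)
Lemma ev_and v a b p q : ev v a = b2z p -> (p -> ev v b = b2z q) ->
  ev v (tand a b) = b2z (p && q).
Proof. by move=> /= ->; case: p => [->|_] //; rewrite ?mul1r ?mul0r. Qed.

Lemma ev_imp v a b p q : ev v a = b2z p -> (p -> ev v b = b2z q) ->
  ev v (timp a b) = b2z (p ==> q).
Proof.
move=> ha hb; rewrite (ev_not (p := p && ~~ q)) ?negb_and ?negbK -?implybE //.
by apply: ev_and => // /hb; apply: ev_not.
Qed.

Lemma ev_or v a b p q : ev v a = b2z p -> ev v b = b2z q ->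
  ev v (tor a b) = b2z (p || q).
Proof.
move=> ha hb; rewrite (ev_not (p := ~~ p && ~~ q)) ?negb_and ?negbK //.
by apply: ev_and => [|_]; apply: ev_not.
Qed.

Lemma ev_lt v a b : ev v (tlt a b) = b2z (ev v a < ev v b).
Proof. by rewrite /= subr_gt0. Qed.

Lemma ev_le v a b : ev v (tle a b) = b2z (ev v a <= ev v b).
Proof. by rewrite (ev_not (ev_lt _ _ _)) -leNgt. Qed.

Lemma ev_eq v a b : ev v (teq a b) = b2z (ev v a == ev v b).
Proof.
by rewrite (ev_and (ev_le _ _ _) (fun _ => ev_le _ _ _)) -eq_le.
Qed.

Lemma ev_scale v a b p z : ev v a = b2z p -> (p -> ev v b = z) ->
  ev v (tmul a b) = if p then z else 0.
Proof. by move=> /= ->; case: p => [->|_] //; rewrite ?mul1r ?mul0r. Qed.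

Lemma ev_if v c a b p y z : ev v c = b2z p -> ev v a = y -> ev v b = z ->
  ev v (tif c a b) = if p then y else z.
Proof. by rewrite /= => -> -> ->; case: p; rewrite ?mul1r ?mul0r ?addr0 ?add0r. Qed.

Lemma ev_all v t P : (forall k, (k < N)%N -> ev (k%:Z :: v) t = b2z (P k)) ->
  ev v (tall t) = b2z (all P (iota 0 N)).
Proof.
move=> h; rewrite /= big_seq (eq_bigr (fun i => b2z (P i))); last first.
  by move=> i; rewrite mem_index_iota => /h.
rewrite -big_seq /index_iota subn0; elim: (iota 0 N) => [|i s IH]; first by rewrite big_nil.
by rewrite big_cons IH /=; case: (P i) => //; rewrite ?mul1r ?mul0r.
Qed.

Lemma ev_ex v t P : (forall k, (k < N)%N -> ev (k%:Z :: v) t = b2z (P k)) ->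
  ev v (tex t) = b2z (has P (iota 0 N)).
Proof.
move=> h; rewrite /= big_seq (eq_bigr (fun i => b2z (P i))); last first.
  by move=> i; rewrite mem_index_iota => /h.
rewrite -big_seq /index_iota subn0 (_ : \sum_(i <- _) _ = (count P (iota 0 N))%:Z).
  by rewrite has_count ltz_nat.
elim: (iota 0 N) => [|i s IH]; first by rewrite big_nil.
by rewrite big_cons IH /= PoszD.
Qed.

Lemma ev_first v t P :
  (forall k j, (k < N)%N -> ev (k%:Z :: j%:Z :: v) t = b2z (P k)) ->
  ev v (tfirst t) = find P (iota 0 N).
Proof.
move=> h; have hf := find_size P (iota 0 N); rewrite size_iota in hf.
rewrite [LHS]/= big_seq (eq_bigr (fun j => b2z (j < find P (iota 0 N))%N)); last first.
  move=> j; rewrite mem_index_iota => /andP[_ jN].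
  rewrite -[LHS]/(ev (j%:Z :: v) (tall (tnot (tand (tle (Arg 0) (Arg 1)) t)))).
  rewrite (@ev_all _ _ (fun k => ~~ ((k <= j)%N && P k))); last first.
    move=> k kN; apply: ev_not; apply: ev_and => [|_]; last exact: h.
    by rewrite ev_le /= lez_nat.
  rewrite ltnNge find_iota (leqNgt N) jN orFb -all_predC; congr b2z.
  apply/allP/allP => H k; rewrite mem_iota add0n => /andP[_ hk].
    have := H k; rewrite mem_iota add0n (leq_ltn_trans (hk : k <= j)%N jN).
    by move=> /(_ isT) /=; rewrite (hk : k <= j)%N.
  rewrite negb_and; case: leqP => //= kj; apply: H.
  by rewrite mem_iota add0n ltnS.
rewrite -big_seq /index_iota subn0.
move: (find _ _) hf => f; elim: N => [|m IH] fm.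
  by rewrite big_nil; case: f fm.
rewrite -(addn1 m) iotaD big_cat big_seq1 /= add0n.
move: fm; rewrite leq_eqVlt => /predU1P[->|fm].
  rewrite leqnn big_seq (eq_bigr (fun=> 1)); last first.
    by move=> i; rewrite mem_iota add0n => /andP[_ im]; rewrite ltnS (ltnW im).
  rewrite -big_seq big_const_seq count_predT size_iota iter_addr_0 natz.
  by rewrite /b2z -PoszD addn1.
by rewrite IH // ltnNge -ltnS fm addr0.
Qed.

End Logic.

(** * The data of the instance as terms *)

Definition tnitems := Inp (Cst 0).
(** The product of all positive entries of the input: a common denominator of the
    data, of length at most the size of the input. *)
Definition tdenom := Prd (tif (tlt (Cst 0) (Inp (Arg 0))) (Inp (Arg 0)) (Cst 1)).

(** [q] is the position of the numerator of a rational number, which is followed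
    by its denominator. *)
Definition tscaled q := tmul (Inp q) (tdiv tdenom (Inp (tadd q (Cst 1)))).

(* An item consists of its number of levels, the 2 cells of its profit, and 4
   cells per level, for the weight and the cost. *)
Definition tlevels i := Inp (Off i).
Definition tprofit i := tscaled (tadd (Off i) (Cst 1)).
Definition tweight i l := tscaled (tadd (Off i) (tadd (Cst 3) (tmul (Cst 4) l))).
Definition tcost i l := tscaled (tadd (Off i) (tadd (Cst 5) (tmul (Cst 4) l))).
Definition tknapsack := tscaled (Cst 1).
Definition timprovement := tscaled (Cst 3).

Section Data.
Variable I : instance.
Local Notation n := (nitems I).
Local Notation N := (size (encode I)).
Local Notation ev := (value (input I) (offset I) N).

Definition denom : int :=
  \prod_(0 <= q < N) (if 0 < input I q then input I q else 1).

Definition scaled (x : rat) : int := numq x * (denom %/ denq x)%Z.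

Lemma denom_gt0 : 0 < denom.
Proof. by apply: prodr_gt0 => q _; case: ifP. Qed.

Lemma dvd_denom k : (k < N)%N -> 0 < input I k -> (input I k %| denom)%Z.
Proof.
move=> kN gt0; rewrite /denom big_mkord (bigD1 (Ordinal kN)) //= gt0.
by apply: dvdz_mulr.
Qed.

Lemma scaledE x : (denq x %| denom)%Z -> (scaled x)%:~R = x * denom%:~R :> rat.
Proof.
move=> /dvdzP[m dm]; rewrite /scaled dm mulzK ?denq_neq0 // !rmorphM /=.
by rewrite [X in X * _ = _]numqE; ring.
Qed.

Lemma nth_item (i : 'I_n) l e : (l <= levels i)%N -> (e < 4)%N ->
  nth 0 (encode_item i) (3 + (4 * l + e)) =
  nth 0 (encode_rat (weight i l) ++ encode_rat (cost i l)) e.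
Proof.
move=> lJ e4; rewrite -[LHS]/(nth 0 (flatten _) (4 * l + e)).
set ss := map _ _; have sh : shape ss = nseq (levels i).+1 4.
  have len4 s : shape [seq encode_rat (weight i k) ++ encode_rat (cost i k) | k <- s]
      = nseq (size s) 4.
    by elim: s => //= a s ->.
  by rewrite len4 size_iota.
have nl : nth [::] ss l = encode_rat (weight i l) ++ encode_rat (cost i l).
  by rewrite (nth_map 0%N) ?size_iota // nth_iota.
by rewrite -nl -nth_flatten_block ?nl // sh take_nseq ?leqW // sumn_nseq.
Qed.

Lemma item_lt (i : 'I_n) d : (d < 7 + 4 * levels i)%N -> (item_pos I i + d < N)%N.
Proof. by have := item_pos_le I i.+1; rewrite item_posS; lia. Qed.

Definition rat_at k x := [/\ (k.+1 < N)%N, input I k = numq x & input I k.+1 = denq x].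

Lemma rat_profit (i : 'I_n) : rat_at (item_pos I i + 1) (profit i).
Proof.
by split; [rewrite -addnS; apply: item_lt; lia|rewrite input_item|rewrite -addnS input_item].
Qed.

Lemma rat_weight (i : 'I_n) l : (l <= levels i)%N ->
  rat_at (item_pos I i + (3 + 4 * l)) (weight i l).
Proof.
move=> lJ; split.
- by rewrite -addnS; apply: item_lt; lia.
- by rewrite input_item; [rewrite -[(4 * l)%N]addn0 nth_item|lia].
- by rewrite -addnS input_item; [rewrite -[(4 * l)%N]addn0 -!addnS nth_item|lia].
Qed.

Lemma rat_cost (i : 'I_n) l : (l <= levels i)%N ->
  rat_at (item_pos I i + (5 + 4 * l)) (cost i l).
Proof.
move=> lJ; have -> : (5 + 4 * l = 3 + (4 * l + 2))%N by lia.
split.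
- by rewrite -addnS; apply: item_lt; lia.
- by rewrite input_item; [rewrite nth_item|lia].
- by rewrite -!addnS input_item; [rewrite nth_item|lia].
Qed.

Lemma rat_knapsack : rat_at 1 (knapsack_budget I).
Proof. by split=> //; have := nitems_le I; lia. Qed.

Lemma rat_improvement : rat_at 3 (improvement_budget I).
Proof. by split=> //; have := nitems_le I; lia. Qed.

Lemma rat_scaledE k x : rat_at k x -> (scaled x)%:~R = x * denom%:~R :> rat.
Proof. by move=> [kN _ dx]; apply: scaledE; rewrite -dx dvd_denom // dx denq_gt0. Qed.

Lemma rat_scaled_ge0 k x : rat_at k x -> 0 <= x -> 0 <= scaled x.
Proof.
move=> /rat_scaledE e x0; rewrite -(ler0z rat) e mulr_ge0 // ler0z.
exact/ltW/denom_gt0.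
Qed.

Lemma ev_tdenom v : ev v tdenom = denom.
Proof.
apply: eq_bigr => q _.
pose x := Inp (Arg 0); pose v' := q%:Z :: v.
exact: (@ev_if _ _ _ v' (tlt (Cst 0) x) x (Cst 1) _ _ _
  (ev_lt (input I) (offset I) N v' (Cst 0) x) erefl erefl).
Qed.

Lemma ev_tscaled v t k x : rat_at k x -> ev v t = k%:Z -> ev v (tscaled t) = scaled x.
Proof.
move=> [_ kx k1x] tk; rewrite /tscaled.
rewrite -[LHS]/(input I `|ev v t| * (ev v tdenom %/ input I `|ev v t + 1|)%Z).
by rewrite tk ev_tdenom -PoszD addn1 !absz_nat kx k1x.
Qed.

Lemma ev_off v t (i : 'I_n) : ev v t = i%:Z -> ev v (Off t) = item_pos I i.
Proof. by move=> /= ->; rewrite absz_nat /offset ltn_ord. Qed.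

Lemma ev_tlevels v t (i : 'I_n) : ev v t = i%:Z -> ev v (tlevels t) = levels i.
Proof. by move=> /ev_off e; rewrite -[LHS]/(input I `|ev v (Off t)|) e absz_nat input_levels. Qed.

Lemma ev_tprofit v t (i : 'I_n) : ev v t = i%:Z ->
  ev v (tprofit t) = scaled (profit i).
Proof.
move=> /ev_off e; apply: ev_tscaled (rat_profit i) _.
by rewrite -[LHS]/(ev v (Off t) + 1) e PoszD.
Qed.

Lemma ev_tweight v t u (i : 'I_n) l : ev v t = i%:Z -> ev v u = l%:Z ->
  (l <= levels i)%N -> ev v (tweight t u) = scaled (weight i l).
Proof.
move=> /ev_off e h lJ; apply: ev_tscaled (rat_weight lJ) _.
by rewrite -[LHS]/(ev v (Off t) + (3 + 4 * ev v u)) e h; lia.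
Qed.

Lemma ev_tcost v t u (i : 'I_n) l : ev v t = i%:Z -> ev v u = l%:Z ->
  (l <= levels i)%N -> ev v (tcost t u) = scaled (cost i l).
Proof.
move=> /ev_off e h lJ; apply: ev_tscaled (rat_cost lJ) _.
by rewrite -[LHS]/(ev v (Off t) + (5 + 4 * ev v u)) e h; lia.
Qed.

Lemma ev_tknapsack v : ev v tknapsack = scaled (knapsack_budget I).
Proof. exact: ev_tscaled rat_knapsack _. Qed.

Lemma ev_timprovement v : ev v timprovement = scaled (improvement_budget I).
Proof. exact: ev_tscaled rat_improvement _. Qed.

End Data.

(** * The trials as terms *)

Definition tsurrogate i k g l :=
  tadd (tmul (tweight i k) (tsub (tadd timprovement (Cst 1)) (tcost g l)))
       (tmul (tcost i k) (tsub (tadd tknapsack (Cst 1)) (tweight g l))).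

(* In what follows [i], [g], [l] and [h] are the de Bruijn indices of variables:
   they are increased by one under each binder that is crossed, and by two by
   [tfirst]. *)
Definition tcheapest i g l :=
  tfirst (tand (tle (Arg 0) (tlevels (Arg i.+2)))
    (tall (timp (tle (Arg 0) (tlevels (Arg i.+3)))
       (tle (tsurrogate (Arg i.+3) (Arg 1) (Arg g.+3) (Arg l.+3))
            (tsurrogate (Arg i.+3) (Arg 0) (Arg g.+3) (Arg l.+3)))))).

Definition tsize i g l := tsurrogate (Arg i) (tcheapest i g l) (Arg g) (Arg l).

Definition tdenser i h g l :=
  let x := tmul (tsize i g l) (tprofit (Arg h)) in
  let y := tmul (tsize h g l) (tprofit (Arg i)) in
  tor (tlt x y) (tand (tle x y) (tlt (Arg i) (Arg h))).

Definition tadmits i g l h :=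
  tand (tand (tlt (Cst 0) (tprofit (Arg i)))
             (tle (tprofit (Arg i)) (tprofit (Arg g))))
       (timp (tlt (Arg h) tnitems) (tdenser i h g l)).

Definition tgreedy i g l h :=
  tif (teq (Arg i) (Arg g)) (tadd (Arg l) (Cst 1))
      (tmul (tadmits i g l h) (tadd (tcheapest i g l) (Cst 1))).

Definition tload (f : term -> term -> term) g l h :=
  Sum (tmul (tlt (Arg 0) tnitems)
      (tmul (tlt (Cst 0) (tgreedy 0 g.+1 l.+1 h.+1))
            (f (Arg 0) (tsub (tgreedy 0 g.+1 l.+1 h.+1) (Cst 1))))).

Definition tfits g l h :=
  tand (tle (tload tweight g l h) tknapsack) (tle (tload tcost g l h) timprovement).

(** An infeasible greedy assignment is replaced by the empty one, so that every
    triple yields a feasible assignment. *)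
Definition ttrial i g l h :=
  tmul (tand (tlt (Arg g) tnitems) (tand (tle (Arg l) (tlevels (Arg g))) (tfits g l h)))
       (tgreedy i g l h).

Definition tgain g l h :=
  Sum (tmul (tlt (Arg 0) tnitems)
      (tmul (tlt (Cst 0) (ttrial 0 g.+1 l.+1 h.+1)) (tprofit (Arg 0)))).

Definition tbest g l h :=
  tall (tall (tall (tle (tgain 2 1 0) (tgain g.+3 l.+3 h.+3)))).

(** The value to be written in cell [k], which is the free variable.  The best
    triple is found as the first [g] which can be completed to a best triple,
    then the first such [l], then the first such [h].  Item [i] takes [levels i + 1]
    cells in the output and [4 (levels i + 1) + 3] in the input, hence its level
    [l] corresponds to the cell [k] with
    [offset i + 4 l = 4 k + 5 + 3 i]. *)
Definition toutput :=
  Let (tfirst (tex (tex (tbest 2 1 0))))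
 (Let (tfirst (tex (tbest 3 1 0)))
 (Let (tfirst (tbest 3 2 0))
 (tex (tex (tand (tlt (Arg 1) tnitems)
    (tand (tle (Arg 0) (tlevels (Arg 1)))
    (tand (teq (tadd (Off (Arg 1)) (tmul (Cst 4) (Arg 0)))
               (tadd (tmul (Cst 4) (Arg 5)) (tadd (Cst 5) (tmul (Cst 3) (Arg 1)))))
          (tlt (Arg 0) (ttrial 1 4 3 2))))))))).

Section Trials.
Variable I : instance.
Local Notation n := (nitems I).
Local Notation N := (size (encode I)).
Local Notation ev := (value (input I) (offset I) N).

Definition sprofit (i : 'I_n) := scaled I (profit i).
Definition sweight (i : 'I_n) l := scaled I (weight i l).
Definition scost (i : 'I_n) l := scaled I (cost i l).
Definition knapsack_int := scaled I (knapsack_budget I).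
Definition improvement_int := scaled I (improvement_budget I).

Definition surrogateI := surrogate sweight scost knapsack_int improvement_int.

Definition cheapest (g : 'I_n) l (i : 'I_n) : nat :=
  find (fun k => (k <= levels i)%N &&
    all (fun k' => (k' <= levels i)%N ==> (surrogateI g l i k <= surrogateI g l i k')) (iota 0 N))
    (iota 0 N).

Lemma cheapestP g l i : (cheapest g l i <= levels i)%N /\
  forall k, (k <= levels i)%N -> surrogateI g l i (cheapest g l i) <= surrogateI g l i k.
Proof.
set P := fun k => (k <= levels i)%N &&
    all (fun k' => (k' <= levels i)%N ==> (surrogateI g l i k <= surrogateI g l i k')) (iota 0 N).
have JN : (levels i < N)%N by have := levels_le i; lia.
have : has P (iota 0 N).
  case: (@Order.TotalTheory.arg_minP _ _ _ (ord0 : 'I_(levels i).+1) xpredT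
    (fun k => surrogateI g l i k) isT) => k _ kmin.
  apply/hasP; exists (k : nat).
    by rewrite mem_iota /= add0n (leq_ltn_trans _ JN) // -ltnS.
  rewrite /P -ltnS ltn_ord; apply/allP => k' _; apply/implyP => k'J.
  exact: (kmin (Ordinal (k'J : k' < (levels i).+1)%N)).
move=> h; have := nth_find 0%N h.
have fN : (find P (iota 0 N) < N)%N by rewrite -[X in (_ < X)%N](size_iota 0) -has_find.
rewrite nth_iota // add0n => /andP[le /allP min]; split=> // k kJ.
by have := min k; rewrite mem_iota /= add0n (leq_ltn_trans kJ JN) kJ => /(_ isT).
Qed.

Local Notation greedyI := (greedy sprofit sweight scost knapsack_int improvement_int cheapest).
Local Notation fitI := (fits sweight scost knapsack_int improvement_int).
Local Notation admitsI := (admits sprofit sweight scost knapsack_int improvement_int cheapest).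

Definition trial g l h (i : 'I_n) : nat :=
  if insub g is Some g' then
    if (l <= levels g')%N &&
       fitI (greedyI g' l h)
    then greedyI g' l h i else 0%N
  else 0%N.

Definition best g l h :=
  all (fun g' => all (fun l' => all (fun h' =>
    gain sprofit (trial g' l' h') <= gain sprofit (trial g l h))
    (iota 0 N)) (iota 0 N)) (iota 0 N).

Lemma ev_tsurrogate v ti tk tg tl (i g : 'I_n) k l :
  ev v ti = i%:Z -> ev v tk = k%:Z -> ev v tg = g%:Z -> ev v tl = l%:Z ->
  (k <= levels i)%N -> (l <= levels g)%N ->
  ev v (tsurrogate ti tk tg tl) = surrogateI g l i k.
Proof.
move=> hi hk hg hl kJ lJ.
rewrite -[LHS]/(ev v (tweight ti tk) * (ev v timprovement + 1 - ev v (tcost tg tl)) +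
  ev v (tcost ti tk) * (ev v tknapsack + 1 - ev v (tweight tg tl))).
rewrite (ev_tweight hi hk kJ) (ev_tcost hi hk kJ).
by rewrite (ev_tweight hg hl lJ) (ev_tcost hg hl lJ) ev_tknapsack ev_timprovement.
Qed.

Lemma ev_tcheapest v i g l (i' g' : 'I_n) l' :
  nth 0 v i = i'%:Z -> nth 0 v g = g'%:Z -> nth 0 v l = l'%:Z ->
  (l' <= levels g')%N -> ev v (tcheapest i g l) = cheapest g' l' i'.
Proof.
move=> hi hg hl lJ; apply: ev_first => k j kN.
have Ji w x : ev w (Arg x) = i'%:Z -> ev w (tle (Arg 0) (tlevels (Arg x))) =
    b2z (ev w (Arg 0) <= (levels i')%:Z).
  by move=> h; rewrite ev_le (ev_tlevels h).
apply: ev_and; first by rewrite Ji.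
move=> kJ; apply: ev_all => k' k'N; apply: ev_imp; first by rewrite Ji.
by move=> k'J; rewrite ev_le; congr (b2z (_ <= _)); apply: ev_tsurrogate.
Qed.

Lemma ev_tsize v i g l (i' g' : 'I_n) l' :
  nth 0 v i = i'%:Z -> nth 0 v g = g'%:Z -> nth 0 v l = l'%:Z ->
  (l' <= levels g')%N -> ev v (tsize i g l) = surrogateI g' l' i' (cheapest g' l' i').
Proof.
move=> hi hg hl lJ; apply: ev_tsurrogate => //; first exact: ev_tcheapest.
by case: (cheapestP g' l' i').
Qed.

Lemma ev_tadmits v i g l h (i' g' : 'I_n) l' h' :
  nth 0 v i = i'%:Z -> nth 0 v g = g'%:Z -> nth 0 v l = l'%:Z -> nth 0 v h = h'%:Z ->
  (l' <= levels g')%N ->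
  ev v (tadmits i g l h) = b2z (admitsI g' l' h' i').
Proof.
move=> hi hg hl hh lJ; rewrite /admits.
have Pp x (x' : 'I_n) : nth 0 v x = x'%:Z -> ev v (tprofit (Arg x)) = sprofit x'.
  exact: (@ev_tprofit I v (Arg x) x').
apply: ev_and => [|_].
  apply: ev_and => [|_]; first by rewrite ev_lt (Pp i i').
  by rewrite ev_le (Pp i i') // (Pp g g').
have en : ev v (tlt (Arg h) tnitems) = b2z (h' < n)%N by rewrite ev_lt /= hh ltz_nat.
rewrite /in_prefix; case: insubP => [h2 hlt eh|hge]; last first.
  by rewrite (ev_imp (q := false) en) (negPf hge).
  set q := denser _ _ _ _; rewrite (ev_imp (q := q) en) ?hlt // => _.
  have hh2 : nth 0 v h = h2%:Z by rewrite hh -eh.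
  have xE : ev v (tmul (tsize i g l) (tprofit (Arg h))) =
     surrogateI g' l' i' (cheapest g' l' i') * sprofit h2.
    by rewrite -(ev_tsize hi hg hl lJ) -(Pp h h2).
  have yE : ev v (tmul (tsize h g l) (tprofit (Arg i))) =
     surrogateI g' l' h2 (cheapest g' l' h2) * sprofit i'.
    by rewrite -(ev_tsize hh2 hg hl lJ) -(Pp i i').
  apply: ev_or; first by rewrite ev_lt xE yE.
  apply: ev_and => [|_]; first by rewrite ev_le xE yE.
  by rewrite ev_lt /= hi hh2 ltz_nat.
Qed.

Lemma ev_tgreedy v i g l h (i' g' : 'I_n) l' h' :
  nth 0 v i = i'%:Z -> nth 0 v g = g'%:Z -> nth 0 v l = l'%:Z -> nth 0 v h = h'%:Z ->
  (l' <= levels g')%N ->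
  ev v (tgreedy i g l h) = greedyI g' l' h' i'.
Proof.
move=> hi hg hl hh lJ; rewrite /greedy.
have eq : ev v (teq (Arg i) (Arg g)) = b2z (i' == g').
  by rewrite ev_eq /= hi hg eqz_nat.
have hl1 : ev v (tadd (Arg l) (Cst 1)) = l'.+1 by rewrite /= hl; lia.
have hc : ev v (tadd (tcheapest i g l) (Cst 1)) = (cheapest g' l' i').+1.
  by rewrite -[LHS]/(ev v (tcheapest i g l) + 1) (ev_tcheapest hi hg hl lJ); lia.
rewrite (ev_if eq hl1 (ev_scale (ev_tadmits hi hg hl hh lJ) (fun _ => hc))).
by case: eqP => // _; case: ifP.
Qed.

Lemma nitems_lt : (n < N)%N. Proof. by have := nitems_le I; lia. Qed.

(** Ranges run up to the length of the input; the guard cuts them down to the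
    items. *)
Lemma ev_item_sum v t (F : 'I_n -> int) :
  (forall i : 'I_n, ev (i%:Z :: v) t = F i) ->
  ev v (Sum (tmul (tlt (Arg 0) tnitems) t)) = \sum_i F i.
Proof.
move=> h; rewrite -[LHS]/(\sum_(0 <= i < N) ev (i%:Z :: v) (tmul (tlt (Arg 0) tnitems) t)).
have lt k : ev (k%:Z :: v) (tlt (Arg 0) tnitems) = b2z (k < n)%N by rewrite ev_lt /= ltz_nat.
pose X i := ev (Posz i :: v) (tmul (tlt (Arg 0) tnitems) t).
have -> : \sum_(0 <= i < N) X i = \sum_(0 <= i < n) X i + \sum_(n <= i < N) X i.
  by apply: big_cat_nat => //; apply/ltnW/nitems_lt.
rewrite [X in _ + X]big_nat_cond [X in _ + X]big1 ?addr0 ?big_mkord; last first.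
  by move=> k /andP[/andP[nk _] _]; rewrite /X (ev_scale (lt k) (fun _ => erefl)) ltnNge nk.
apply: eq_bigr => i _.
by rewrite /X (ev_scale (lt i) (fun _ => h i)) ltn_ord.
Qed.

Lemma greedy_le g l h i : (l <= levels g)%N ->
  (greedyI g l h i <= (levels i).+1)%N.
Proof.
move=> lJ; rewrite /greedy; case: eqP => [->|_] //; case: ifP => // _.
by rewrite ltnS; case: (cheapestP g l i).
Qed.

Lemma ev_tload (v : seq int) f (f' : 'I_n -> nat -> int) g l h (g' : 'I_n) l' h' :
  (forall v t u (i : 'I_n) k, ev v t = i%:Z -> ev v u = k%:Z ->
     (k <= levels i)%N -> ev v (f t u) = f' i k) ->
  nth 0 v g = g'%:Z -> nth 0 v l = l'%:Z -> nth 0 v h = h'%:Z -> (l' <= levels g')%N ->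
  ev v (tload f g l h) = load f' (greedyI g' l' h').
Proof.
move=> hf hg hl hh lJ; rewrite /load big_mkcond; apply: ev_item_sum => i.
have hgr : ev (i%:Z :: v) (tgreedy 0 g.+1 l.+1 h.+1) = greedyI g' l' h' i.
  exact: ev_tgreedy.
apply: ev_scale => [|pos]; first by rewrite ev_lt hgr.
apply: hf => //; last by have := greedy_le h' i lJ; lia.
by rewrite -[LHS]/(ev _ (tgreedy 0 g.+1 l.+1 h.+1) - 1) hgr; lia.
Qed.

Lemma ev_tfits v g l h (g' : 'I_n) l' h' :
  nth 0 v g = g'%:Z -> nth 0 v l = l'%:Z -> nth 0 v h = h'%:Z -> (l' <= levels g')%N ->
  ev v (tfits g l h) =
  b2z (fitI (greedyI g' l' h')).
Proof.
move=> hg hl hh lJ; apply: ev_and => [|_]; rewrite ev_le ?ev_tknapsack ?ev_timprovement.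
  by rewrite (ev_tload (f' := sweight) _ hg hl hh lJ) // => *; apply: ev_tweight.
by rewrite (ev_tload (f' := scost) _ hg hl hh lJ) // => *; apply: ev_tcost.
Qed.

Lemma ev_ttrial v i g l h (i' : 'I_n) g' l' h' :
  nth 0 v i = i'%:Z -> nth 0 v g = g'%:Z -> nth 0 v l = l'%:Z -> nth 0 v h = h'%:Z ->
  ev v (ttrial i g l h) = trial g' l' h' i'.
Proof.
move=> hi hg hl hh; rewrite /trial.
have lt : ev v (tlt (Arg g) tnitems) = b2z (g' < n)%N by rewrite ev_lt /= hg ltz_nat.
case: insubP => [g2 hlt eg|hge]; last first.
  by rewrite (@ev_scale _ _ _ _ _ _ false 0) // (ev_and lt (q := false)) ?(negPf hge).
have hg2 : nth 0 v g = g2%:Z by rewrite hg -eg.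
have ok : ev v (tand (tlt (Arg g) tnitems) (tand (tle (Arg l) (tlevels (Arg g))) (tfits g l h))) =
   b2z ((g' < n)%N && ((l' <= levels g2)%N && fitI (greedyI g2 l' h'))).
  apply: (ev_and lt) => _; apply: ev_and => [|lJ]; last exact: ev_tfits.
  by rewrite ev_le (@ev_tlevels I v (Arg g) g2) //= hl lez_nat.
rewrite (ev_scale ok (z := (greedyI g2 l' h' i')%:Z)).
  by rewrite hlt /=; case: ifP.
by move=> /and3P[_ lJ _]; apply: ev_tgreedy.
Qed.

Lemma ev_tgain v g l h g' l' h' :
  nth 0 v g = g'%:Z -> nth 0 v l = l'%:Z -> nth 0 v h = h'%:Z ->
  ev v (tgain g l h) = gain sprofit (trial g' l' h').
Proof.
move=> hg hl hh; rewrite /gain big_mkcond; apply: ev_item_sum => i.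
apply: ev_scale => [|_]; last exact: ev_tprofit.
by rewrite ev_lt (@ev_ttrial _ _ _ _ _ i g' l' h').
Qed.

Lemma ev_tbest v g l h g' l' h' :
  nth 0 v g = g'%:Z -> nth 0 v l = l'%:Z -> nth 0 v h = h'%:Z ->
  ev v (tbest g l h) = b2z (best g' l' h').
Proof.
move=> hg hl hh; apply: ev_all => g1 _; apply: ev_all => l1 _; apply: ev_all => h1 _.
by rewrite ev_le (@ev_tgain _ _ _ _ g1 l1 h1) // (@ev_tgain _ _ _ _ g' l' h').
Qed.

Lemma best_exists : exists g l h, [/\ (g < N)%N, (l < N)%N, (h < N)%N & best g l h].
Proof.
have N0 : (0 < N)%N by exact: leq_ltn_trans nitems_lt.
pose z := Ordinal N0.
case: (@Order.TotalTheory.arg_maxP _ _ _ (z, z, z) xpredT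
   (fun x : 'I_N * 'I_N * 'I_N => gain sprofit (trial x.1.1 x.1.2 x.2)) isT) => [[[g l] h] _ m].
exists g, l, h; split=> //.
apply/allP => g1; rewrite mem_iota => /andP[_ hg].
apply/allP => l1; rewrite mem_iota => /andP[_ hl].
apply/allP => h1; rewrite mem_iota => /andP[_ hh].
exact: (m (Ordinal hg, Ordinal hl, Ordinal hh)).
Qed.

Lemma find_iota_has P : has P (iota 0 N) ->
  (find P (iota 0 N) < N)%N /\ P (find P (iota 0 N)).
Proof.
move=> h; have fN : (find P (iota 0 N) < N)%N by rewrite -[X in (_ < X)%N](size_iota 0) -has_find.
by have := nth_find 0%N h; rewrite nth_iota.
Qed.

Lemma ev_toutput : exists g l h, best g l h /\
  forall k, ev [:: k%:Z] toutput = b2z [exists i : 'I_n,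
     [exists j : 'I_(levels i).+1,
        (item_pos I i + 4 * j == 4 * k + (5 + 3 * i))%N && (j < trial g l h i)%N]].
Proof.
pose exh g l := has (best g l) (iota 0 N).
pose exl g := has (exh g) (iota 0 N).
pose G := find exl (iota 0 N).
pose L := find (exh G) (iota 0 N).
pose H := find (best G L) (iota 0 N).
have [_ bl] : (G < N)%N /\ exl G.
  apply: find_iota_has; have [g [l [h [gN lN hN b]]]] := best_exists.
  apply/hasP; exists g; first by rewrite mem_iota.
  apply/hasP; exists l; first by rewrite mem_iota.
  by apply/hasP; exists h; first by rewrite mem_iota.
have [_ bh] := find_iota_has bl; have [_ b] := find_iota_has bh.
exists G, L, H; split=> // k.
rewrite -[LHS]/(ev _ (Let _ (Let _ _))).
have eG : ev [:: k%:Z] (tfirst (tex (tex (tbest 2 1 0)))) = G.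
  by apply: ev_first => g j _; apply: ev_ex => l _; apply: ev_ex => h _; apply: ev_tbest.
have eL : ev [:: G%:Z; k%:Z] (tfirst (tex (tbest 3 1 0))) = L.
  by apply: ev_first => l j _; apply: ev_ex => h _; apply: ev_tbest.
have eH : ev [:: L%:Z; G%:Z; k%:Z] (tfirst (tbest 3 2 0)) = H.
  by apply: ev_first => h j _; apply: ev_tbest.
have letE v a b' z : ev v a = z -> ev v (Let a b') = ev (z :: v) b' by move=> <-.
rewrite (letE _ _ _ _ eG) (letE _ _ _ _ eL) (letE _ _ _ _ eH).
pose pred i j := if insub i is Some i' then
  [&& (j <= levels (i' : 'I_n))%N, (item_pos I i' + 4 * j == 4 * k + (5 + 3 * i'))%N
    & (j < trial G L H i')%N]
  else false.
rewrite (@ev_ex _ _ _ _ _ (fun i => has (pred i) (iota 0 N))); last first.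
  move=> i _; apply: ev_ex => j _; rewrite /pred.
  have lt v' : ev [:: j%:Z, i%:Z & v'] (tlt (Arg 1) tnitems) = b2z (i < n)%N.
    by rewrite ev_lt /= ltz_nat.
  case: insubP => [i' hlt ei|hge]; last first.
    by rewrite (ev_and (lt _) (q := false)) ?(negPf hge).
  set body := [&& _, _ & _]; have -> : body = (i < n)%N && body by rewrite hlt.
  rewrite -ei; apply: ev_and => [|_]; first by rewrite ei lt.
  apply: ev_and => [|_]; first by rewrite ev_le (@ev_tlevels I _ (Arg 1) i') //= lez_nat.
  apply: ev_and => [|_].
    rewrite ev_eq; congr b2z.
    set v' := _ :: _.
    by rewrite -[X in X == _]/(ev v' (Off (Arg 1)) + 4 * j%:Z) (@ev_off I v' (Arg 1) i').
  by rewrite ev_lt (@ev_ttrial _ _ _ _ _ i' G L H) //= ltz_nat.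
congr b2z; apply/hasP/existsP => [[i _ /hasP[j _]]|[i /existsP[j hj]]].
  rewrite /pred; case: insubP => // i' _ _ /and3P[jJ c t]; exists i'.
  by apply/existsP; exists (Ordinal (jJ : j < (levels i').+1)%N); rewrite c.
exists (i : nat); first by rewrite mem_iota /= add0n (ltn_trans _ nitems_lt).
apply/hasP; exists (j : nat).
  rewrite mem_iota /= add0n (leq_trans (ltn_ord j)) //.
  by have := levels_le i; rewrite addnS => /ltnW/(leq_trans _); apply; rewrite ltnS leq_addr.
by rewrite /pred valK -ltnS ltn_ord.
Qed.

End Trials.

(** * Assignments and solutions *)

Lemma telescope_levels (f : nat -> rat) m a : (a <= m.+1)%N ->
  f 0%N * (0 < a)%N%:R + \sum_(1 <= l < m.+1) (f l - f l.-1) * (l < a)%N%:R =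
  if (0 < a)%N then f a.-1 else 0.
Proof.
elim: m a => [|m IH] a am.
  by rewrite big_geq // addr0; case: a am => [|[|//]]; rewrite ?mulr0 ?mulr1.
rewrite big_nat_recr //= addrA; move: am; rewrite leq_eqVlt => /predU1P[->|am].
  rewrite ltnSn (eq_big_nat _ _ (F2 := fun l => (f l - f l.-1) * (l < m.+1)%N%:R)).
    by have := IH m.+1 (leqnn _); rewrite !ltn0Sn => ->; rewrite mulr1 /= addrC subrK.
  by move=> l /andP[_ lm]; rewrite lm ltnW.
have -> : (m.+1 < a)%N = false by lia.
by rewrite IH -1?ltnS // mulr0 addr0.
Qed.

Section Link.
Variable I : instance.
Local Notation n := (nitems I).
Local Notation fit := (fits (@sweight I) (@scost I) (knapsack_int I) (improvement_int I)).
Local Notation greedyI :=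
  (greedy (@sprofit I) (@sweight I) (@scost I) (knapsack_int I) (improvement_int I) (@cheapest I)).
Implicit Type a : 'I_n -> nat.

Definition solution_of a : solution I := Solution (fun i => 0 < a i)%N (fun i l => l < a i)%N.

Definition in_range a := forall i, (a i <= (levels i).+1)%N.

Lemma total_weight_solution_of a : in_range a ->
  total_weight (solution_of a) = \sum_(i | (0 < a i)%N) weight i (a i).-1.
Proof.
move=> ra; rewrite /total_weight -big_split [RHS]big_mkcond.
by apply: eq_bigr => i _; apply: telescope_levels.
Qed.

Lemma improvement_cost_solution_of a : in_range a ->
  improvement_cost (solution_of a) = \sum_(i | (0 < a i)%N) cost i (a i).-1.
Proof.
move=> ra; rewrite /improvement_cost [RHS]big_mkcond.
by apply: eq_bigr => i _; rewrite -(telescope_levels _ (ra i)) cost0 mul0r add0r.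
Qed.

Lemma load_scaled (f : 'I_n -> nat -> rat) a : in_range a ->
  (forall i l, (l <= levels i)%N -> (scaled I (f i l))%:~R = f i l * (denom I)%:~R :> rat) ->
  (load (fun i l => scaled I (f i l)) a)%:~R =
  (\sum_(i | (0 < a i)%N) f i (a i).-1) * (denom I)%:~R :> rat.
Proof.
move=> ra h; rewrite /load rmorph_sum mulr_suml; apply: eq_bigr => i ai.
by apply: h; have := ra i; lia.
Qed.

Lemma denom_rat_gt0 : 0 < (denom I)%:~R :> rat.
Proof. by rewrite ltr0z denom_gt0. Qed.

Lemma feasible_solution_of a : in_range a -> feasible (solution_of a) <-> fit a.
Proof.
move=> ra; have D0 := denom_rat_gt0.
have W : (load (@sweight I) a <= knapsack_int I) =
    (total_weight (solution_of a) <= knapsack_budget I).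
  rewrite -(ler_int rat) load_scaled // => [|i l li]; last exact/rat_scaledE/rat_weight.
  by rewrite (rat_scaledE (rat_knapsack I)) ler_pM2r // total_weight_solution_of.
have C : (load (@scost I) a <= improvement_int I) =
    (improvement_cost (solution_of a) <= improvement_budget I).
  rewrite -(ler_int rat) load_scaled // => [|i l li]; last exact/rat_scaledE/rat_cost.
  by rewrite (rat_scaledE (rat_improvement I)) ler_pM2r // improvement_cost_solution_of.
rewrite /fits W C; split=> [[-> -> _ _] //|/andP[hW hC]].
split=> // [i _|i l _]; apply/implyP => /=; lia.
Qed.

Lemma objective_solution_of a :
  (gain (@sprofit I) a)%:~R = objective (solution_of a) * (denom I)%:~R :> rat.
Proof.
rewrite /gain /objective rmorph_sum mulr_suml big_mkcond; apply: eq_bigr => i _ /=.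
case: (0 < a i)%N; rewrite ?mulr1 ?mulr0 ?mul0r //.
exact/rat_scaledE/rat_profit.
Qed.

Lemma ler_objective a b :
  (objective (solution_of a) <= objective (solution_of b)) =
  (gain (@sprofit I) a <= gain (@sprofit I) b).
Proof. by rewrite -(ler_int rat) !objective_solution_of ler_pM2r // denom_rat_gt0. Qed.

(** By the chain constraints the ones in [x_i, y_i^1, ..., y_i^j(i)] come first;
    [a i] is their number. *)
Lemma feasible_assignment (s : solution I) : feasible s -> exists a,
  [/\ in_range a, feasible (solution_of a) & objective s = objective (solution_of a)].
Proof.
move=> [hW hC hx hy].
pose z i l := if l is 0 then xsol s i else ysol s i l.
pose a i := find (fun l => ~~ z i l) (iota 0 (levels i).+1).
have za i l : (l <= levels i)%N -> z i l = (l < a i)%N.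
  move=> lJ; rewrite ltnNge /a find_iota ltnNge lJ orFb -all_predC.
  have dec k : (k < levels i)%N -> z i k.+1 -> z i k.
    case: k => [|k] kJ; first by apply/implyP/hx.
    by apply/implyP/hy.
  apply/idP/allP => [zl k|H]; last first.
    by have := H l; rewrite mem_iota add0n ltnSn => /(_ isT) /=; rewrite negbK.
  rewrite mem_iota add0n ltnS => /andP[_ kl] /=; rewrite negbK.
  elim: l kl lJ zl => [|l IH]; first by rewrite leqn0 => /eqP->.
  rewrite leq_eqVlt => /predU1P[-> //|kl] lJ /(dec _ lJ).
  exact: IH kl (ltnW lJ).
have ra : in_range a.
  by move=> i; rewrite (leq_trans (find_size _ _)) // size_iota.
have xE i : xsol s i = (0 < a i)%N by rewrite -za.
have yE i l : (0 < l <= levels i)%N -> ysol s i l = (l < a i)%N.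
  by case/andP=> l0 lJ; rewrite -za //; case: l l0 lJ.
have sumE (f : 'I_n -> nat -> rat) :
   \sum_i \sum_(1 <= l < (levels i).+1) (f i l - f i l.-1) * (ysol s i l)%:R =
   \sum_i \sum_(1 <= l < (levels i).+1) (f i l - f i l.-1) * (l < a i)%N%:R.
  apply: eq_bigr => i _; rewrite big_nat_cond [RHS]big_nat_cond.
  by apply: eq_bigr => l /andP[lJ _]; rewrite yE.
have WE : total_weight s = total_weight (solution_of a).
  rewrite /total_weight sumE; congr (_ + _).
  by apply: eq_bigr => i _; rewrite xE.
have CE : improvement_cost s = improvement_cost (solution_of a) by exact: sumE.
exists a; split=> //; last by apply: eq_bigr => i _; rewrite xE.
by split; rewrite -?WE -?CE // => i; [|move=> l] => _; apply/implyP => /=; lia.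
Qed.

Lemma trial_range g l h : in_range (trial g l h).
Proof.
move=> i; rewrite /trial; case: insub => // g'; case: ifP => // /andP[lJ _].
exact: greedy_le.
Qed.

Lemma fit_nothing : fit (fun=> 0%N).
Proof.
rewrite /fits /load !big_pred0 //.
rewrite (rat_scaled_ge0 (rat_knapsack I)) ?(rat_scaled_ge0 (rat_improvement I)) //.
  exact: improvement_budget_ge0.
exact: knapsack_budget_ge0.
Qed.

Lemma trial_fit g l h : fit (trial g l h).
Proof.
rewrite /trial; case: insub => [g'|]; last exact: fit_nothing.
case: (boolP ((l <= levels g')%N && _)) => [/andP[]//|_]; exact: fit_nothing.
Qed.

(** The triple provided by [greedy_third] is among those that the best one has
    been compared with. *)
Lemma best_third g l h a : best I g l h -> in_range a -> fit a ->
  gain (@sprofit I) a <= 3 * gain (@sprofit I) (trial g l h).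
Proof.
move=> b ra fa; set v := gain _ (trial g l h).
have p0 i : 0 <= sprofit (I := I) i.
  exact/(rat_scaled_ge0 (rat_profit _))/profit_ge0.
have gain0 a' : 0 <= gain (@sprofit I) a' by apply: sumr_ge0.
have [pos|npos] := ltP 0 (gain (@sprofit I) a); last first.
  by apply: le_trans npos _; rewrite mulr_ge0 // gain0.
have w0 i k : (k <= levels i)%N -> 0 <= sweight (I := I) i k.
  by move=> kJ; apply/(rat_scaled_ge0 (rat_weight kJ))/weight_ge0.
have c0 i k : (k <= levels i)%N -> 0 <= scost (I := I) i k.
  move=> kJ; apply/(rat_scaled_ge0 (rat_cost kJ)).
  elim: k kJ => [|k IH] kJ; first by rewrite cost0.
  exact: le_trans (IH (ltnW kJ)) (cost_mono kJ).
have [g1 [l1 [h1 [lJ hn gf le3]]]] :=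
  @greedy_third n (@levels I) (@sprofit I) (@sweight I) (@scost I)
  (knapsack_int I) (improvement_int I) (@cheapest I) p0 w0 c0 (fun g l i => (cheapestP g l i).1)
  (fun g l i k => (cheapestP g l i).2 k) a ra fa pos.
apply: le_trans le3 _; rewrite ler_pM2l //.
have tE : trial g1 l1 h1 =1 greedyI g1 l1 h1.
  by move=> i; rewrite /trial valK lJ gf.
have -> : gain (@sprofit I) (greedyI g1 l1 h1)
   = gain (@sprofit I) (trial g1 l1 h1).
  by apply: eq_bigl => i; rewrite tE.
have N1 : (g1 < size (encode I))%N by apply: ltn_trans (ltn_ord _) (nitems_lt I).
have N2 : (l1 < size (encode I))%N.
  by apply: leq_ltn_trans lJ _; have := levels_le g1; lia.
have N3 : (h1 < size (encode I))%N by apply: leq_ltn_trans hn (nitems_lt I).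
move: b => /allP/(_ g1); rewrite mem_iota add0n N1 => /(_ isT).
move=> /allP/(_ l1); rewrite mem_iota add0n N2 => /(_ isT).
by move=> /allP/(_ h1); rewrite mem_iota add0n N3 => /(_ isT).
Qed.

(** An optimum exists since assignments range over a finite set. *)
Lemma optimal_exists : exists2 a, in_range a & optimal (solution_of a).
Proof.
pose M := (\max_(i < n) (levels i)).+2.
have JM (i : 'I_n) : ((levels i).+1 < M)%N by rewrite !ltnS; apply: leq_bigmax.
pose P (f : {ffun 'I_n -> 'I_M}) :=
  [forall i, (f i <= (levels i).+1)%N] && fit (fun i => f i : nat).
have P0 : P [ffun=> ord0].
  apply/andP; split; first by apply/forallP => i; rewrite ffunE.
  by have := fit_nothing; rewrite /fits /load !big_pred0 // => i; rewrite ffunE.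
case: (@Order.TotalTheory.arg_maxP _ _ _ _ P (fun f => gain (@sprofit I) (fun i => f i : nat)) P0).
move=> f /andP[/forallP rf ff] fmax; exists (fun i => f i : nat) => //.
split; first exact/feasible_solution_of.
move=> s' /feasible_assignment[a [ra fa ->]]; rewrite ler_objective.
pose f' := [ffun i => Ordinal (leq_ltn_trans (ra i) (JM i))].
have f'E i : f' i = a i :> nat by rewrite ffunE.
have gE : gain (@sprofit I) a = gain (@sprofit I) (fun i => f' i : nat).
  by apply: eq_bigl => i; rewrite f'E.
rewrite gE; apply: fmax; apply/andP; split.
  by apply/forallP => i; rewrite f'E ra.
have lE w : load w (fun i => f' i : nat) = load w a.
  by rewrite /load; apply: eq_big => i; rewrite f'E.
by rewrite /fits !lE; apply/(feasible_solution_of ra).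
Qed.

Definition sol_blocks a :=
  [seq [seq ((l < a i)%N : nat)%:Z | l <- iota 0 (levels i).+1] | i <- enum 'I_n].

Lemma size_sol_blocks a : size (sol_blocks a) = n.
Proof. by rewrite size_map size_enum_ord. Qed.

Lemma nth_sol_blocks a (i : 'I_n) : nth [::] (sol_blocks a) i =
  [seq ((l < a i)%N : nat)%:Z | l <- iota 0 (levels i).+1].
Proof. by rewrite (nth_map i) ?size_enum_ord // nth_ord_enum. Qed.

Lemma encode_solution_of a : encode_solution (solution_of a) = flatten (sol_blocks a).
Proof.
rewrite /encode_solution /sol_blocks; congr flatten; apply: eq_map => i /=.
Qed.

(** An item takes 3 cells of the input, and 4 more for each cell that it takes in
    the output. *)
Lemma item_pos_cells a k : (k <= n)%N ->
  item_pos I k = (5 + 3 * k + 4 * sumn (take k (shape (sol_blocks a))))%N.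
Proof.
elim: k => [|k IH] kn; first by rewrite item_pos0 take0.
have sz : size (shape (sol_blocks a)) = n by rewrite size_map size_sol_blocks.
rewrite (item_posS (Ordinal kn)) (take_nth 0%N) ?sz // -cats1 sumn_cat /= IH ?(ltnW kn) //.
rewrite (nth_map [::]) ?size_sol_blocks // (nth_sol_blocks _ (Ordinal kn)).
by rewrite size_map size_iota; lia.
Qed.

Lemma nth_sol_block a (i : 'I_n) j : (j <= levels i)%N ->
  nth 0 (flatten (sol_blocks a)) (sumn (take i (shape (sol_blocks a))) + j) =
  ((j < a i)%N : nat)%:Z.
Proof.
move=> jJ; rewrite nth_flatten_block nth_sol_blocks ?size_map ?size_iota //.
by rewrite (nth_map 0%N) ?size_iota // nth_iota.
Qed.

Lemma outputs_solution_of a m :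
  (forall k, (k < size (encode I))%N -> m 1%N k =
    b2z [exists i : 'I_n, [exists j : 'I_(levels i).+1,
      (item_pos I i + 4 * j == 4 * k + (5 + 3 * i))%N && (j < a i)%N]]) ->
  outputs m (solution_of a).
Proof.
move=> hm k; rewrite encode_solution_of => kl.
have szb := size_sol_blocks a.
have kN : (k < size (encode I))%N.
  apply: leq_trans kl _; rewrite size_encode (item_pos_cells a) //.
  rewrite take_oversize; last by rewrite size_map szb.
  by rewrite size_flatten; move: (sumn _) => x; lia.
rewrite hm //.
have match_nth (i : 'I_n) (j : 'I_(levels i).+1) :
   (item_pos I i + 4 * j == 4 * k + (5 + 3 * i))%N ->
   nth 0 (flatten (sol_blocks a)) k = ((j < a i)%N : nat)%:Z.
  rewrite (item_pos_cells a (ltnW (ltn_ord i))) => /eqP e.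
  have jJ : (j <= levels i)%N by rewrite -ltnS.
  rewrite -(nth_sol_block a jJ); congr nth.
  by move: e; move: (sumn _) => x; lia.
case: (boolP [exists i, _]) => [/existsP[i /existsP[j /andP[e ja]]]|none].
  by rewrite (match_nth i j e) ja.
set sh := shape (sol_blocks a).
have ksh : (k < sumn sh)%N by rewrite -size_flatten.
have rP := reshape_indexP ksh; have oP := reshape_offsetP ksh.
have rn : (reshape_index sh k < n)%N by rewrite -szb -(size_map size).
pose i := Ordinal rn.
have hj : (reshape_offset sh k < (levels i).+1)%N.
  apply: leq_trans oP _; rewrite /sh (nth_map [::]) ?szb //.
  by rewrite (nth_sol_blocks a i) size_map size_iota.
pose j := Ordinal hj.
have e : (item_pos I i + 4 * j == 4 * k + (5 + 3 * i))%N.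
  have := reshape_indexK sh k; rewrite /flatten_index (item_pos_cells a (ltnW (ltn_ord i))) -/sh /=.
  by move: (sumn (take _ _)) => x; lia.
rewrite (match_nth i j e); case: (boolP (j < a i)%N) => // ja.
by case/negP: none; apply/existsP; exists i; apply/existsP; exists j; rewrite e.
Qed.

End Link.

Theorem theorem4p5 :
  exists (A : program) (T : {poly nat}),
  forall I : instance,
  exists (t : nat) (m : memory) (s : solution I),
  [/\ run A (input_memory I) t m,
      (t <= T.[input_size I])%N,
      outputs m s,
      feasible s
    & exists2 s0 : solution I,
        optimal s0 & objective s >= 1 / 3 * objective s0].
Proof.
have [e1 pre] := preludeP; have [e2 tab] := tabulateP toutput.
exists (Seq prelude (tabulate toutput)), (('X + 2%:P) ^+ (2 + (e1 + e2))) => I.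
have [t1 [m1 [r1 ht1 h0 h2 h3]]] := pre I.
have [t2 [m2 [r2 ht2 out]]] := tab I m1 h0 h2 h3.
have [g [l [h [b outE]]]] := ev_toutput I.
have ra := @trial_range I g l h; have fa := @trial_fit I g l h.
exists (t1 + t2)%N, m2, (solution_of (trial g l h)); split.
- exact: RunSeq r1 r2.
- rewrite horner_exp hornerD hornerX hornerC.
  have -> : input_size I + 2%:R = (input_size I).+2 by rewrite -[RHS]addn2.
  rewrite natrXE; have X1 : (1 < (input_size I).+2)%N by [].
  have := mul_expn_le 2 (e1 + e2) X1.
  have := expn_le X1 (leq_addr e2 e1); have := expn_le X1 (leq_addl e1 e2).
  by lia.
- by apply: outputs_solution_of => k kN; rewrite out // outE.
- exact/feasible_solution_of.
have [a0 ra0 opt] := optimal_exists I; exists (solution_of a0); first exact: opt.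
have fa0 : fits (@sweight I) (@scost I) (knapsack_int I) (improvement_int I) a0.
  by apply/feasible_solution_of; case: opt.
have := best_third b ra0 fa0; rewrite -(ler_int rat) rmorphM /= !objective_solution_of.
rewrite mulrA ler_pM2r; last exact: denom_rat_gt0.
move=> le3.
by rewrite mul1r ler_pdivrMl.
Qed.
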